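(* Let $(\mathfrak{J},\mathfrak{M})$ be a $\mathfrak{J}$-ternary superalgebra. Then $\mathfrak{B}^s(\mathfrak{J},\mathfrak{M})$ is a Lie superalgebra with (super-anticommutative) bracket given by $$[\{a\otimes b\},\{c\otimes d\}]:=\langle a,b\rangle(\{c\otimes d\}),\quad [\{a\otimes b\},\{m\otimes n\}]:=\langle a,b\rangle(\{m\otimes n\}),\quad [\{m\otimes n\},\{r\otimes s\}]:=\partial_{m,n}(\{r\otimes s\})$$ for $a,b,c,d\in\mathfrak{J}$, $m,n,r,s\in\mathfrak{M}$, and the map $\phi:\mathfrak{B}^s(\mathfrak{J},\mathfrak{M})\to\mathrm{InnDer}(\mathfrak{J},\mathfrak{M})$ determined by $\{a\otimes b\}\mapsto\langle a,b\rangle$, $\{m\otimes n\}\mapsto\partial_{m,n}$ is a central extension of Lie superalgebras.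
   Context: Everything is over $\mathbb{C}$; superspaces are $\mathbb{Z}_2$-graded. A Jordan superalgebra is a superspace $\mathfrak{J}$ with an even product satisfying $a\cdot b=(-1)^{|a||b|}b\cdot a$ and $(a\cdot b)\cdot(c\cdot d)+(-1)^{|b||c|}(a\cdot c)\cdot(b\cdot d)+(-1)^{|b||d|+|c||d|}(a\cdot d)\cdot(b\cdot c)=((a\cdot b)\cdot c)\cdot d+(-1)^{|b||c|+|b||d|+|c||d|}((a\cdot d)\cdot c)\cdot b+(-1)^{|a||b|+|a||c|+|a||d|+|c||d|}((b\cdot d)\cdot c)\cdot a$. A special $\mathfrak{J}$-supermodule is a superspace $\mathfrak{M}$ with an even bilinear $\bullet:\mathfrak{J}\otimes\mathfrak{M}\to\mathfrak{M}$ such that $(a\cdot b)\bullet m=\tfrac12(a\bullet(b\bullet m)+(-1)^{|a||b|}b\bullet(a\bullet m))$. A $\mathfrak{J}$-ternary superalgebra $(\mathfrak{J},\mathfrak{M})$ consists of a Jordan superalgebra $(\mathfrak{J},\cdot)$, a special $\mathfrak{J}$-supermodule $(\mathfrak{M},\bullet)$, an even super-anticommutative bilinear map $\star:\mathfrak{M}\otimes\mathfrak{M}\to\mathfrak{J}$ ($m\star n=-(-1)^{|m||n|}n\star m$) and an even trilinear product $(-,-,-):\mathfrak{M}^{\otimes3}\to\mathfrak{M}$ such that for all homogeneous $a\in\mathfrak{J}$, $m,n,r,s,t\in\mathfrak{M}$: (SJT1) $a\cdot(m\star n)=\tfrac12((a\bullet m)\star n+(-1)^{|a||m|}m\star(a\bullet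 n))$; (SJT2) $a\bullet(m,n,s)=(a\bullet m,n,s)-(-1)^{|a||m|}(m,a\bullet n,s)+(-1)^{|a|(|m|+|n|)}(m,n,a\bullet s)$; (SJT3) $(m,n,s)=(-1)^{|m|(|n|+|s|)+|n||s|}(s,n,m)-(-1)^{|n||s|}(m\star s)\bullet n$; (SJT4) $(m,n,s)=(-1)^{|m||n|}(n,m,s)+(m\star n)\bullet s$; (SJT5) $(m,n,r)\star s+(-1)^{|r|(|m|+|n|)}r\star(m,n,s)=(-1)^{|n|(|r|+|s|)}m\star((r\star s)\bullet n)$; (SJT6) $(m,n,(r,s,t))=((m,n,r),s,t)+(-1)^{|r|(|m|+|n|)+|m||n|}(r,(n,m,s),t)+(-1)^{(|m|+|n|)(|r|+|s|)}(r,s,(m,n,t))$. For homogeneous $a,b,c\in\mathfrak{J}$, $m,n,r\in\mathfrak{M}$, the endomorphisms $\langle a,b\rangle,\partial_{m,n}\in\mathrm{End}(\mathfrak{J}\oplus\mathfrak{M})$ are defined by $\langle a,b\rangle(c)=a\cdot(b\cdot c)-(-1)^{|a||b|}b\cdot(a\cdot c)$, $\langle a,b\rangle(m)=\tfrac14(a\bullet(b\bullet m)-(-1)^{|a||b|}b\bullet(a\bullet m))$, $\partial_{m,n}(a)=\tfrac12((-1)^{|a|(|m|+|n|)}(a\bullet m)\star n-(-1)^{|a||n|}m\star(a\bullet n))$, $\partial_{m,n}(r)=\tfrac12(m\star n)\bullet r-(m,n,r)$. $\mathrm{InnDer}(\mathfrak{J},\mathfrak{M})\subseteq\mathrm{End}(\mathfrak{J}\oplus\mathfrak{M})$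 is the linear span of all $\langle a,b\rangle$ and $\partial_{m,n}$, a Lie superalgebra under the supercommutator. $\mathfrak{B}^s(\mathfrak{J},\mathfrak{M})=(\mathfrak{J}\otimes\mathfrak{J}\oplus\mathfrak{M}\otimes\mathfrak{M})/R^s(\mathfrak{J},\mathfrak{M})$, where $R^s(\mathfrak{J},\mathfrak{M})$ is spanned by the following elements, for homogeneous $a,b,c\in\mathfrak{J}$, $m,n,r,s\in\mathfrak{M}$: $I_{a,b}=a\otimes b+(-1)^{|a||b|}b\otimes a$; $I_{m,n}=m\otimes n-(-1)^{|m||n|}n\otimes m$; $I_{a,b,c}=(-1)^{|a||c|}(a\cdot b)\otimes c+(-1)^{|a||b|}(b\cdot c)\otimes a+(-1)^{|b||c|}(c\cdot a)\otimes b$; $I_{a,m,n}=(a\bullet m)\otimes n-(-1)^{|a||m|}m\otimes(a\bullet n)-(-1)^{|a|(|m|+|n|)}2(m\star n)\otimes a$; $I_{m,n,r,s}=\partial_{m,n}(r)\otimes s+(-1)^{(|m|+|n|)|r|}r\otimes\partial_{m,n}(s)+(-1)^{(|m|+|n|)(|r|+|s|)}\partial_{r,s}(m)\otimes n+(-1)^{(|r|+|s|)|n|}m\otimes\partial_{r,s}(n)$. The class of $a\otimes b$ is $\{a\otimes b\}$, that of $m\otimes n$ is $\{m\otimes n\}$. $\mathrm{InnDer}(\mathfrak{J},\mathfrak{M})$ acts on $\mathfrak{J}\otimes\mathfrak{J}\oplus\mathfrak{M}\otimes\mathfrak{M}$ by $D(z_1\otimes z_2)=D(z_1)\otimes z_2+(-1)^{|D||z_1|}z_1\otimes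 D(z_2)$, and this induces an action on $\mathfrak{B}^s(\mathfrak{J},\mathfrak{M})$. A central extension is a surjective morphism of Lie superalgebras with central kernel. *)

(* Defs.v *)
From HB Require Import structures.
From mathcomp Require Import all_boot all_order all_algebra.
From mathcomp Require Import generic_quotient ring_quotient sesquilinear.
From mathcomp Require Import all_classical all_reals prodnormedzmodule.
From mathcomp.real_closed Require Import complex.
From mathcomp.multinomials Require Import freeg.

Set Implicit Arguments.
Unset Strict Implicit.
Unset Printing Implicit Defensive.

Import GRing.Theory.
Local Open Scope ring_scope.
Local Open Scope classical_set_scope.
Local Open Scope quotient_scope.

Section LinearMaps.
Context (K : comNzRingType) (U V : lmodType K).
Implicit Types f g h : {linear U -> V}.

Lemma linear_ext f g : f =1 g -> f = g.
Proof.
case: f => f [[f1] [f2]]; case: g => g [[g1] [g2]] /= /funext fg.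
by subst g; congr GRing.Linear.Pack; congr GRing.Linear.Class;
  congr (_ _); apply: Prop_irrelevance.
Qed.

Definition lin_zero : {linear U -> V} := \0.
Definition lin_opp f : {linear U -> V} := \- f.
Definition lin_add f g : {linear U -> V} := f \+ g.
Definition lin_scale (c : K) f : {linear U -> V} := c \*: f.

Fact lin_addA : associative lin_add.
Proof. by move=> f g h; apply: linear_ext => u /=; rewrite addrA. Qed.
Fact lin_addC : commutative lin_add.
Proof. by move=> f g; apply: linear_ext => u /=; rewrite addrC. Qed.
Fact lin_add0 : left_id lin_zero lin_add.
Proof. by move=> f; apply: linear_ext => u /=; rewrite add0r. Qed.
Fact lin_addN : left_inverse lin_zero lin_opp lin_add.
Proof. by move=> f; apply: linear_ext => u /=; rewrite addNr. Qed.

HB.instance Definition _ := GRing.isZmodule.Build {linear U -> V}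
  lin_addA lin_addC lin_add0 lin_addN.

Fact lin_scaleA c d f : lin_scale c (lin_scale d f) = lin_scale (c * d) f.
Proof. by apply: linear_ext => u /=; rewrite scalerA. Qed.
Fact lin_scale1 : left_id 1 lin_scale.
Proof. by move=> f; apply: linear_ext => u /=; rewrite scale1r. Qed.
Fact lin_scaleDr : right_distributive lin_scale +%R.
Proof. by move=> c f g; apply: linear_ext => u /=; rewrite scalerDr. Qed.
Fact lin_scaleDl f : {morph lin_scale^~ f : c d / c + d}.
Proof. by move=> c d; apply: linear_ext => u /=; rewrite scalerDl. Qed.

HB.instance Definition _ := GRing.Zmodule_isLmodule.Build K {linear U -> V}
  lin_scaleA lin_scale1 lin_scaleDr lin_scaleDl.

End LinearMaps.

Section Span.
Context (K : nzRingType) (V : lmodType K).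

Definition span (S : set V) : set V :=
  [set v | exists (n : nat) (c : 'I_n -> K) (x : 'I_n -> V),
     (forall i, S (x i)) /\ v = \sum_i c i *: x i].

Lemma spanS (S : set V) : S `<=` span S.
Proof.
move=> v Sv; exists 1%N, (fun=> 1), (fun=> v); split=> //.
by rewrite big_ord1 scale1r.
Qed.

Definition in_span (S : set V) : {pred V} := fun v => `[< span S v >].

Fact in_span_submod_closed (S : set V) : submod_closed (in_span S).
Proof.
split=> [|k u v /asboolP[n [c [x [Sx ->]]]] /asboolP[m [d [y [Sy ->]]]]].
  by apply/asboolP; exists 0%N, (fun=> 0), (fun=> 0); split=> [[]|]; rewrite ?big_ord0.
apply/asboolP; exists (n + m).
exists (fun i => match fintype.split i with inl j => k * c j | inr j => d j end).
exists (fun i => match fintype.split i with inl j => x j | inr j => y j end).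
split=> [i|]; first by case: (fintype.split i).
rewrite big_split_ord scaler_sumr; congr (_ + _); apply: eq_bigr => i _.
  by rewrite (unsplitK (inl i)) scalerA.
by rewrite (unsplitK (inr i)).
Qed.

HB.instance Definition _ (S : set V) :=
  GRing.isSubmodClosed.Build K V (in_span S) (in_span_submod_closed S).

End Span.

(* The quotient of V by the subspace spanned by S. *)
Section QuotientModule.
Context (K : nzRingType) (V : lmodType K) (S : set V).

Definition quot_span := Quotient.quot (in_span S).
HB.instance Definition _ := GRing.Zmodule.on quot_span.

Definition quot_class (v : V) : quot_span := \pi_(Quotient.quot (in_span S)) v.

Definition quot_scale (c : K) (x : quot_span) : quot_span :=
  quot_class (c *: repr x).

Lemma quot_classP u v : quot_class u = quot_class v <-> span S (u - v).
Proof.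
split=> [/eqP | uv]; first by rewrite -Quotient.idealrBE => /asboolP.
by apply/eqP; rewrite -Quotient.idealrBE; apply/asboolP.
Qed.

Fact quot_class_additive : zmod_morphism quot_class.
Proof. by move=> u v; rewrite /quot_class raddfB. Qed.
HB.instance Definition _ :=
  GRing.isZmodMorphism.Build V quot_span quot_class quot_class_additive.

Lemma quot_classK (x : quot_span) : quot_class (repr x) = x.
Proof. exact: reprK. Qed.

Lemma quot_scaleE c v : quot_scale c (quot_class v) = quot_class (c *: v).
Proof.
apply/quot_classP; rewrite -scalerBr; apply/asboolP.
rewrite -[`[< _ >]]/(_ \in in_span S) rpredZ //.
by apply/asboolP/quot_classP; rewrite quot_classK.
Qed.

Fact quot_scaleA c d x : quot_scale c (quot_scale d x) = quot_scale (c * d) x.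
Proof. by rewrite -(quot_classK x) !quot_scaleE scalerA. Qed.
Fact quot_scale1 : left_id 1 quot_scale.
Proof. by move=> x; rewrite -(quot_classK x) quot_scaleE scale1r. Qed.
Fact quot_scaleDr : right_distributive quot_scale +%R.
Proof.
move=> c x y; rewrite -(quot_classK x) -(quot_classK y).
by rewrite -raddfD !quot_scaleE scalerDr raddfD.
Qed.
Fact quot_scaleDl x : {morph quot_scale^~ x : c d / c + d}.
Proof.
by move=> c d; rewrite -(quot_classK x) !quot_scaleE scalerDl raddfD.
Qed.
HB.instance Definition _ := GRing.Zmodule_isLmodule.Build K quot_span
  quot_scaleA quot_scale1 quot_scaleDr quot_scaleDl.

Fact quot_class_scalable : scalable quot_class.
Proof. by move=> c v; rewrite /= -quot_scaleE. Qed.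
HB.instance Definition _ :=
  GRing.isScalable.Build K V quot_span *:%R quot_class quot_class_scalable.

End QuotientModule.

Section Tensor.
Context (K : fieldType) (U V : lmodType K).

Let free_tensor := {freeg (U * V)%type / K}.
Let gen (u : U) (v : V) : free_tensor := << (u, v) >>.

Inductive tensor_rel : set free_tensor :=
| Tensor_rel_l c u u' v :
    tensor_rel (gen (c *: u + u') v - (c *: gen u v + gen u' v))
| Tensor_rel_r c u v v' :
    tensor_rel (gen u (c *: v + v') - (c *: gen u v + gen u v')).

Definition tensor := quot_span tensor_rel.
HB.instance Definition _ := GRing.Lmodule.on tensor.

Definition tens (u : U) (v : V) : tensor := quot_class tensor_rel (gen u v).

Fact tens_bilinear : bilinear_for *:%R *:%R tens.
Proof.
split=> [v c u u'|u c v v']; rewrite /tens /= -linearP /=;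
  apply/quot_classP/spanS; constructor.
Qed.
HB.instance Definition _ :=
  bilinear_isBilinear.Build K U V tensor *:%R *:%R tens tens_bilinear.

End Tensor.

(* Parities are Booleans: false is even, true is odd. *)
Record is_superspace (K : nzRingType) (V : lmodType K) (par : bool -> set V) :
    Prop := IsSuperspace {
  par0 : forall i, par i 0;
  parP : forall i (c : K) u v, par i u -> par i v -> par i (c *: u + v);
  par_sum : forall v, exists u w, [/\ par false u, par true w & v = u + w];
  par_cap : forall v, par false v -> par true v -> v = 0
}.

Record superspace (K : nzRingType) := Superspace {
  superspace_sort :> lmodType K;
  par : bool -> set superspace_sort;
  par_superspace : is_superspace par
}.

Section Superspace.
Context (K : nzRingType) (V : superspace K).
Implicit Types (i : bool) (u v : V).

(* The homogeneous component of v of parity i. *)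
Definition hpart i v : V := xget 0 [set u | par i u /\ par (~~ i) (v - u)].

Lemma par_cap_any i v : par i v -> par (~~ i) v -> v = 0.
Proof.
by case: i => /= *; apply: (par_cap (par_superspace V)).
Qed.

Lemma hpart_uniq i u v : par i u -> par (~~ i) (v - u) -> hpart i v = u.
Proof.
move=> pu pvu; apply: xget_unique => // w [pw pvw].
apply/eqP; rewrite -subr_eq0; apply/eqP/(@par_cap_any i).
  by rewrite addrC -scaleN1r; apply: parP => //; apply: par_superspace.
have -> : w - u = (-1) *: (v - w) + (v - u).
  by rewrite scaleN1r opprB addrA subrK.
by apply: parP => //; apply: par_superspace.
Qed.

Lemma hpartP i v : par i (hpart i v) /\ par (~~ i) (v - hpart i v).
Proof.
apply: (@xgetPex _ _ [set u | par i u /\ par (~~ i) (v - u)]).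
have [u [w [pu pw ->]]] := par_sum (par_superspace V) v.
by case: i => /=; [exists w; rewrite addrK|exists u; rewrite addrC addKr].
Qed.

Fact hpart_linear i : linear (hpart i).
Proof.
move=> c u v; have [pu pu'] := hpartP i u; have [pv pv'] := hpartP i v.
apply: hpart_uniq; first exact: (parP (par_superspace V)).
by rewrite opprD addrACA -scalerBr; apply: (parP (par_superspace V)).
Qed.
HB.instance Definition _ i :=
  GRing.isLinear.Build K V V *:%R (hpart i) (hpart_linear i).

(* The linear extension of v |-> (-1)^(n |v|) v. *)
Definition par_sign (n : nat) v : V := hpart false v + (-1) ^+ n *: hpart true v.

Fact par_sign_linear n : linear (par_sign n).
Proof.
move=> c u v; rewrite /par_sign !linearP !scalerDr !scalerA addrACA.
by rewrite -signr_odd; case: (odd n); rewrite ?expr0 ?expr1 ?mulrN1 ?mulN1r ?mulr1 ?mul1r.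
Qed.
HB.instance Definition _ n :=
  GRing.isLinear.Build K V V *:%R (par_sign n) (par_sign_linear n).

Lemma par_signE n i v : par i v -> par_sign n v = (-1) ^+ (n * i) *: v.
Proof.
move=> pv; have h0 : hpart i v = v.
  by apply: hpart_uniq => //; rewrite subrr; apply: (par0 (par_superspace V)).
have h1 : hpart (~~ i) v = 0.
  by apply: hpart_uniq; rewrite ?subr0 ?negbK //; apply: (par0 (par_superspace V)).
rewrite /par_sign; case: i pv h0 h1 => /= _ -> ->.
  by rewrite add0r muln1.
by rewrite scaler0 addr0 muln0 scale1r.
Qed.

End Superspace.

Section SuperAlgebra.
Context (K : fieldType).

Definition even_bilinear (U V W : superspace K) (f : U -> V -> W) : Prop :=
  forall i j u v, par i u -> par j v -> par (i (+) j) (f u v).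

Definition trilinear (V W : lmodType K) (f : V -> V -> V -> W) : Prop :=
  [/\ forall v w, linear (fun u => f u v w),
      forall u w, linear (fun v => f u v w) & forall u v, linear (f u v)].

Definition even_trilinear (V W : superspace K) (f : V -> V -> V -> W) : Prop :=
  forall i j k u v w, par i u -> par j v -> par k w ->
    par (i (+) j (+) k) (f u v w).

Record is_jordan_superalgebra (J : superspace K) (dot : {bilinear J -> J -> J}) :
    Prop := IsJordanSuperalgebra {
  jordan_even : even_bilinear dot;
  jordan_comm : forall i j a b, par i a -> par j b ->
    dot a b = (-1) ^+ (i * j) *: dot b a;
  jordan_identity : forall i j k l a b c d,
    par i a -> par j b -> par k c -> par l d ->
    dot (dot a b) (dot c d)
      + (-1) ^+ (j * k) *: dot (dot a c) (dot b d)
      + (-1) ^+ (j * l + k * l) *: dot (dot a d) (dot b c)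
    = dot (dot (dot a b) c) d
      + (-1) ^+ (j * k + j * l + k * l) *: dot (dot (dot a d) c) b
      + (-1) ^+ (i * j + i * k + i * l + k * l) *: dot (dot (dot b d) c) a
}.

Record is_special_supermodule (J M : superspace K)
    (dot : {bilinear J -> J -> J}) (bul : {bilinear J -> M -> M}) : Prop :=
  IsSpecialSupermodule {
  special_even : even_bilinear bul;
  special_mul : forall i j a b m, par i a -> par j b ->
    bul (dot a b) m
    = 2^-1 *: (bul a (bul b m) + (-1) ^+ (i * j) *: bul b (bul a m))
}.

Record jternary := Jternary {
  jtJ : superspace K;
  jtM : superspace K;
  dot : {bilinear jtJ -> jtJ -> jtJ};
  bul : {bilinear jtJ -> jtM -> jtM};
  star : {bilinear jtM -> jtM -> jtJ};
  tri : jtM -> jtM -> jtM -> jtM;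
  jt_jordan : is_jordan_superalgebra dot;
  jt_special : is_special_supermodule dot bul;
  jt_star_even : even_bilinear star;
  jt_star_anticomm : forall i j m n, par i m -> par j n ->
    star m n = - (-1) ^+ (i * j) *: star n m;
  jt_tri_linear : trilinear tri;
  jt_tri_even : even_trilinear tri;
  SJT1 : forall p i j a m n, par p a -> par i m -> par j n ->
    dot a (star m n)
    = 2^-1 *: (star (bul a m) n + (-1) ^+ (p * i) *: star m (bul a n));
  SJT2 : forall p i j k a m n s,
    par p a -> par i m -> par j n -> par k s ->
    bul a (tri m n s)
    = tri (bul a m) n s - (-1) ^+ (p * i) *: tri m (bul a n) s
      + (-1) ^+ (p * (i + j)) *: tri m n (bul a s);
  SJT3 : forall i j k m n s, par i m -> par j n -> par k s ->
    tri m n s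
    = (-1) ^+ (i * (j + k) + j * k) *: tri s n m
      - (-1) ^+ (j * k) *: bul (star m s) n;
  SJT4 : forall i j k m n s, par i m -> par j n -> par k s ->
    tri m n s = (-1) ^+ (i * j) *: tri n m s + bul (star m n) s;
  SJT5 : forall i j k l m n r s,
    par i m -> par j n -> par k r -> par l s ->
    star (tri m n r) s + (-1) ^+ (k * (i + j)) *: star r (tri m n s)
    = (-1) ^+ (j * (k + l)) *: star m (bul (star r s) n);
  SJT6 : forall i j k l q m n r s t,
    par i m -> par j n -> par k r -> par l s -> par q t ->
    tri m n (tri r s t)
    = tri (tri m n r) s t
      + (-1) ^+ (k * (i + j) + i * j) *: tri r (tri n m s) t
      + (-1) ^+ ((i + j) * (k + l)) *: tri r s (tri m n t)
}.

Record is_lie_superalgebra (L : lmodType K) (parL : bool -> set L)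
    (br : {bilinear L -> L -> L}) : Prop := IsLieSuperalgebra {
  lie_superspace : is_superspace parL;
  lie_even : forall i j x y, parL i x -> parL j y -> parL (i (+) j) (br x y);
  lie_anticomm : forall i j x y, parL i x -> parL j y ->
    br x y = - (-1) ^+ (i * j) *: br y x;
  lie_jacobi : forall i j k x y z, parL i x -> parL j y -> parL k z ->
    br x (br y z) = br (br x y) z + (-1) ^+ (i * j) *: br y (br x z)
}.

Record is_central_extension (L L' : lmodType K)
    (parL : bool -> set L) (parL' : bool -> set L')
    (br : {bilinear L -> L -> L}) (br' : {bilinear L' -> L' -> L'})
    (f : {linear L -> L'}) : Prop := IsCentralExtension {
  central_lie_src : is_lie_superalgebra parL br;
  central_lie_tgt : is_lie_superalgebra parL' br';
  central_even : forall i x, parL i x -> parL' i (f x);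
  central_morph : forall x y, f (br x y) = br' (f x) (f y);
  central_surj : forall y, exists x, f x = y;
  central_ker : forall x, f x = 0 -> forall y, br x y = 0
}.

End SuperAlgebra.

Section Constructions.
Context (K : fieldType) (T : jternary K).
Local Notation J := (jtJ T).
Local Notation M := (jtM T).
Local Notation dot := (dot T).
Local Notation bul := (bul T).
Local Notation star := (star T).
Local Notation tri := (@tri K T).
Local Notation JM := (J * M)%type.
Implicit Types (i j k l p q : bool) (a b c d : J) (m n r s : M).

(* <a, b> on J and on M, for a of parity i and b of parity j. *)
Definition ldotJ i j a b c : J :=
  dot a (dot b c) - (-1) ^+ (i * j) *: dot b (dot a c).
Definition ldotM i j a b m : M :=
  4^-1 *: (bul a (bul b m) - (-1) ^+ (i * j) *: bul b (bul a m)).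

(* \partial_(m, n) on J and on M, for m of parity i and n of parity j. *)
Definition partJ i j m n a : J :=
  2^-1 *: (star (bul (par_sign (i + j) a) m) n
           - star m (bul (par_sign j a) n)).
Definition partM m n r : M := 2^-1 *: bul (star m n) r - tri m n r.

Lemma partJE i j k m n a : par k a ->
  partJ i j m n a = 2^-1 *: ((-1) ^+ (k * (i + j)) *: star (bul a m) n
                             - (-1) ^+ (k * j) *: star m (bul a n)).
Proof.
move=> pa; rewrite /partJ !(par_signE _ pa) (mulnC k) (mulnC k).
by rewrite !(linearZl_LR, linearZr).
Qed.

Fact ldotJ_linear i j a b : linear (ldotJ i j a b).
Proof.
exact: (linearP (dot a \o dot b \- ((-1) ^+ (i * j) \*: (dot b \o dot a))
  : {linear J -> J})).
Qed.
HB.instance Definition _ i j a b :=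
  GRing.isLinear.Build K J J *:%R (ldotJ i j a b) (ldotJ_linear i j a b).

Fact ldotM_linear i j a b : linear (ldotM i j a b).
Proof.
exact: (linearP (4^-1 \*: (bul a \o bul b \- ((-1) ^+ (i * j) \*: (bul b \o bul a)))
  : {linear M -> M})).
Qed.
HB.instance Definition _ i j a b :=
  GRing.isLinear.Build K M M *:%R (ldotM i j a b) (ldotM_linear i j a b).

Fact partJ_linear i j m n : linear (partJ i j m n).
Proof.
move=> c a b; rewrite /partJ !linearP /= !(linearPl, linearPr) /=.
by rewrite opprD addrACA -scalerBr scalerDr !scalerA mulrC.
Qed.
HB.instance Definition _ i j m n :=
  GRing.isLinear.Build K J J *:%R (partJ i j m n) (partJ_linear i j m n).

Fact partM_linear m n : linear (partM m n).
Proof.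
move=> c r s; rewrite /partM linearPr.
have [_ _ ->] := jt_tri_linear T.
by rewrite opprD scalerDr addrACA !scalerA mulrC -scalerA -scalerBr.
Qed.
HB.instance Definition _ m n :=
  GRing.isLinear.Build K M M *:%R (partM m n) (partM_linear m n).

Definition pair_map (f : J -> J) (g : M -> M) (z : JM) : JM := (f z.1, g z.2).

Fact pair_map_linear (f : {linear J -> J}) (g : {linear M -> M}) :
  linear (pair_map f g).
Proof. by move=> c [a m] [b n]; rewrite /pair_map /= !linearP. Qed.
HB.instance Definition _ (f : {linear J -> J}) (g : {linear M -> M}) :=
  GRing.isLinear.Build K JM JM *:%R (pair_map f g) (pair_map_linear f g).

(* <a, b> and \partial_(m, n) as endomorphisms of J (+) M; the Booleans are
   the parities of the two vectors. *)
Definition ldot i j a b : {linear JM -> JM} :=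
  pair_map (ldotJ i j a b) (ldotM i j a b).
Definition part i j m n : {linear JM -> JM} :=
  pair_map (partJ i j m n) (partM m n).

Definition JM_par p : set JM := [set z | par p z.1 /\ par p z.2].

Definition End_par p : set {linear JM -> JM} :=
  [set D | forall q z, JM_par q z -> JM_par (p (+) q) (D z)].

(* The supercommutator of D and E of respective parities p and q. *)
Definition supercomm p q (D E : {linear JM -> JM}) : {linear JM -> JM} :=
  (D \o E : {linear JM -> JM}) - (-1) ^+ (p * q) *: (E \o D : {linear JM -> JM}).

Inductive innder_gen : set {linear JM -> JM} :=
| Innder_dot i j a b of par i a & par j b : innder_gen (ldot i j a b)
| Innder_part i j m n of par i m & par j n : innder_gen (part i j m n).

Record InnDer := MkInnDer {
  innder_val :> {linear JM -> JM};
  _ : innder_val \in in_span innder_gen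
}.
HB.instance Definition _ := [isSub for innder_val].
HB.instance Definition _ := [Choice of InnDer by <:].
HB.instance Definition _ := [SubChoice_isSubLmodule of InnDer by <:].

Definition InnDer_par p : set InnDer := [set D | End_par p (innder_val D)].

Definition JJMM := (tensor J J * tensor M M)%type.
HB.instance Definition _ := GRing.Lmodule.on JJMM.

Definition tensJ a b : JJMM := (tens a b, 0).
Definition tensM m n : JJMM := (0, tens m n).

(* D(z1 (x) z2) for D of parity p and z1 of parity i. *)
Definition actJ p (D : {linear JM -> JM}) i a b : JJMM :=
  tensJ (D (a, 0)).1 b + (-1) ^+ (p * i) *: tensJ a (D (b, 0)).1.
Definition actM p (D : {linear JM -> JM}) i m n : JJMM :=
  tensM (D (0, m)).2 n + (-1) ^+ (p * i) *: tensM m (D (0, n)).2.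

(* The spanning set of R^s(J, M). *)
Inductive Rs_gen : set JJMM :=
| Rs_dot i j a b of par i a & par j b :
    Rs_gen (tensJ a b + (-1) ^+ (i * j) *: tensJ b a)
| Rs_tens i j m n of par i m & par j n :
    Rs_gen (tensM m n - (-1) ^+ (i * j) *: tensM n m)
| Rs_cycle i j k a b c of par i a & par j b & par k c :
    Rs_gen ((-1) ^+ (i * k) *: tensJ (dot a b) c
            + (-1) ^+ (i * j) *: tensJ (dot b c) a
            + (-1) ^+ (j * k) *: tensJ (dot c a) b)
| Rs_bul p i j a m n of par p a & par i m & par j n :
    Rs_gen (tensM (bul a m) n - (-1) ^+ (p * i) *: tensM m (bul a n)
            - (-1) ^+ (p * (i + j)) *: (2 *: tensJ (star m n) a))
| Rs_part i j k l m n r s of par i m & par j n & par k r & par l s :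
    Rs_gen (tensM (partM m n r) s
            + (-1) ^+ ((i + j) * k) *: tensM r (partM m n s)
            + (-1) ^+ ((i + j) * (k + l)) *: tensM (partM r s m) n
            + (-1) ^+ ((k + l) * j) *: tensM m (partM r s n)).

Definition Bs := quot_span Rs_gen.
HB.instance Definition _ := GRing.Lmodule.on Bs.

Definition Bs_class : {linear JJMM -> Bs} := quot_class Rs_gen.

Definition classJ a b : Bs := Bs_class (tensJ a b).
Definition classM m n : Bs := Bs_class (tensM m n).

(* The grading induced by that of J (x) J (+) M (x) M. *)
Inductive Bs_homog p : set Bs :=
| Bs_homogJ i j a b of par i a & par j b & i (+) j = p :
    Bs_homog p (classJ a b)
| Bs_homogM i j m n of par i m & par j n & i (+) j = p :
    Bs_homog p (classM m n).

Definition Bs_par p : set Bs := span (Bs_homog p).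

End Constructions.

Arguments Bs_class {K T}.
Arguments Bs_par {K} T p.
Arguments InnDer_par {K} T p.

(* Main.v *)
Require Import Defs.
From HB Require Import structures.
From mathcomp Require Import all_boot all_order all_algebra.
From mathcomp Require Import sesquilinear all_classical all_reals.
From mathcomp.real_closed Require Import complex.
From mathcomp.multinomials Require Import freeg.
From mathcomp Require Import ring.
Set Implicit Arguments.
Unset Strict Implicit.
Unset Printing Implicit Defensive.
Import GRing.Theory Num.Theory.
Local Open Scope ring_scope.
Local Notation span := Defs.span.

(** Everything rests on one fact: the operators <a, b> and \partial_(m, n) are
    homogeneous derivations of all four products of the ternary superalgebra
    (ldot_derivation, part_derivation).

    A derivation D commutes with the construction of these operators:
    [D, <a, b>] = <D a, b> + <a, D b>, and likewise for \partial_(m, n), up to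
    signs (der_ldotJ, der_ldotM, der_partJ, der_partM).  Two things follow.
    The relations spanning R^s hold for the operators themselves
    (phi_tens_rel): the first four families follow from the axioms by short
    computations (ldotJ_cycle, partJ_bul and their companions), and the last
    one becomes [P, Q] + [Q, P] = 0 up to signs, for P = \partial_(m, n) and
    Q = \partial_(r, s).  And D maps each family of relations into its own
    span (act_rel).  So the morphism phi : B^s -> InnDer and the action of
    InnDer on B^s both descend to the quotient, and the bracket of B^s is
    [x, y] := phi(x) . y.

    Then phi(D . y) = [D, phi(y)] (phiE_Bs_act) makes phi compatible with
    the brackets, and the Jacobi identity is the statement that D |-> D . y is
    an action (Bs_act_supercomm).  The kernel of phi is central because
    [x, y] depends on x only through phi(x).  What remains is
    super-anticommutativity: on M (x) M it is literally the last family of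
    relations, while on J (x) J and between J (x) J and M (x) M it is a
    computation with the other families (brB_antiJJ, brB_antiJM).

    Elements of InnDer need not be homogeneous, so the action and the
    supercommutator are first defined for every endomorphism, through its even
    and odd parts; these are (D + g D g) / 2 and (D - g D g) / 2, where g acts
    by (-1)^p on the part of parity p.  The same involution, carried over to
    B^s, shows that the even and odd parts of B^s meet only in zero
    (flip_par).

    The multilinear identities are checked by bringing both sides to a normal
    form in a vector space, with signs treated as unknowns whose square is 1.
    An identity that follows from several hypotheses u_i = 0 is proved by
    exhibiting the coefficients c_i of a combination of the u_i that equals
    the difference of its two sides; all nontrivial coefficients below are
    signs, or signs divided by 2 or 4. *)

(** * Deciding linear identities in a vector space *)

Inductive lexp (C : Type) :=
| LZero | LAtom of nat | LAdd of lexp C & lexp C | LOpp of lexp C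
| LScale of C & lexp C.
Arguments LZero {C}.
Arguments LAtom {C}.

Section LinearNormalForm.
Context (K : fieldType) (V : lmodType K).

Fixpoint leval (env : seq V) (e : lexp K) : V :=
  match e with
  | LZero => 0
  | LAtom n => nth 0 env n
  | LAdd e1 e2 => leval env e1 + leval env e2
  | LOpp e1 => - leval env e1
  | LScale c e1 => c *: leval env e1
  end.

(** Absent coefficients are kept apart from zero ones, so that the equation
    obtained for an atom mentions only the terms in which this atom occurs. *)
Definition oadd (x y : option K) : option K :=
  match x, y with
  | None, _ => y
  | _, None => x
  | Some a, Some b => Some (a + b)
  end.
Definition omapr (f : K -> K) (x : option K) : option K :=
  match x with None => None | Some a => Some (f a) end.
Definition oval (x : option K) : K := match x with None => 0 | Some a => a end.

Fixpoint lcoef (i : nat) (e : lexp K) : option K :=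
  match e with
  | LZero => None
  | LAtom n => if Nat.eqb n i then Some 1 else None
  | LAdd e1 e2 => oadd (lcoef i e1) (lcoef i e2)
  | LOpp e1 => omapr (fun a => - a) (lcoef i e1)
  | LScale c e1 => omapr (fun a => c * a) (lcoef i e1)
  end.

Lemma leval_coef env e :
  leval env e = \sum_(i < size env) oval (lcoef i e) *: nth 0 env i.
Proof.
elim: e => [|n|e1 IH1 e2 IH2|e1 IH1|c e1 IH1] /=.
- by rewrite big1 // => i _; rewrite scale0r.
- have eqbE (m p : nat) : Nat.eqb m p = (m == p).
    by elim: m p => [|m IH] [|p].
  case: (ltnP n (size env)) => [ltn|len].
    rewrite (bigD1 (Ordinal ltn)) //= eqbE eqxx scale1r big1 ?addr0 // => i ni.
    by rewrite eqbE eq_sym (negPf (ni : (i : nat) != n)) scale0r.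
  rewrite nth_default // big1 // => i _; rewrite eqbE.
  by case: eqP => [ni|_]; rewrite ?scale0r //; move: (ltn_ord i); rewrite -ni ltnNge len.
- rewrite IH1 IH2 -big_split; apply: eq_bigr => i _ /=.
  by case: (lcoef i e1) (lcoef i e2) => [x|] [y|] /=;
    rewrite ?scalerDl ?scale0r ?add0r ?addr0.
- rewrite IH1 -sumrN; apply: eq_bigr => i _.
  by case: (lcoef i e1) => [x|] /=; rewrite ?scaleNr ?scale0r ?oppr0.
- rewrite IH1 scaler_sumr; apply: eq_bigr => i _.
  by case: (lcoef i e1) => [x|] /=; rewrite ?(scale0r, scaler0) ?scalerA.
Qed.

Fixpoint lsame (e1 e2 : lexp K) (n : nat) : Prop :=
  match n with
  | 0 => True
  | n'.+1 => oval (lcoef n' e1) = oval (lcoef n' e2) /\ lsame e1 e2 n'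
  end.

Lemma leval_same env e1 e2 :
  lsame e1 e2 (size env) -> leval env e1 = leval env e2.
Proof.
move=> same; rewrite !leval_coef; apply: eq_bigr => i _; congr (_ *: _).
move: (i : nat) (ltn_ord i) same; elim: (size env) => //= n IH k.
by rewrite ltnS leq_eqVlt => /orP[/eqP-> []//|/IH H [_]].
Qed.

End LinearNormalForm.

(** Atoms that are not syntactically equal may still differ only in the path by
    which an algebraic structure was inferred.  Conversion is tried only when
    the last two arguments agree, as it is very slow on distinct atoms. *)
Ltac same_atom x y :=
  first
  [ constr_eq x y
  | lazymatch x with
    | ?h ?f ?u => lazymatch y with
      | ?k ?g ?v => same_atom u v; same_atom f g; unify x y
      end
    end ].
Ltac atom_index x env :=
  lazymatch env with
  | cons ?y ?r => match tt with
    | _ => let _ := match tt with _ => same_atom x y end in constr:(O)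
    | _ => let n := atom_index x r in constr:(S n)
    end
  end.
Ltac add_atom x env :=
  lazymatch env with
  | nil => constr:(cons x nil)
  | cons ?y ?r => match tt with
    | _ => let _ := match tt with _ => same_atom x y end in env
    | _ => let r' := add_atom x r in constr:(cons y r')
    end
  end.
Ltac lin_atoms t env :=
  lazymatch t with
  | 0%R => env
  | (?a + ?b)%R => let env' := lin_atoms a env in lin_atoms b env'
  | (- ?a)%R => lin_atoms a env
  | (_ *: ?a)%R => lin_atoms a env
  | _ => add_atom t env
  end.
Ltac lin_quote C t env :=
  lazymatch t with
  | 0%R => constr:(@LZero C)
  | (?a + ?b)%R => let a' := lin_quote C a env in
      let b' := lin_quote C b env in constr:(@LAdd C a' b')
  | (- ?a)%R => let a' := lin_quote C a env in constr:(@LOpp C a')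
  | (?c *: ?a)%R => let a' := lin_quote C a env in constr:(@LScale C c a')
  | _ => let n := atom_index t env in constr:(@LAtom C n)
  end.

(** A fixed name for the Koszul sign, which fixes the ring structure in which
    the power is computed: signs coming from different sources become
    syntactically equal. *)
Definition sgn (K : fieldType) (i j : bool) : K := (-1) ^+ (i * j).

Section Signs.
Context (K : fieldType).
Implicit Types i j k : bool.

Lemma sgnE i j : (-1) ^+ (i * j) = sgn K i j.
Proof. by []. Qed.

Lemma sgnC i j : sgn K i j = sgn K j i.
Proof. by rewrite /sgn mulnC. Qed.

Lemma sgn_sq i j : sgn K i j * sgn K i j = 1.
Proof. by rewrite -exprMn mulrNN mulr1 expr1n. Qed.

Lemma sgn_addl i j k : sgn K (i (+) j) k = sgn K i k * sgn K j k.
Proof.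
by rewrite /sgn; case: i; case: j; case: k; rewrite -?exprD ?sqrrN ?expr1n.
Qed.

Lemma sgn_addr i j k : sgn K i (j (+) k) = sgn K i j * sgn K i k.
Proof. by rewrite sgnC sgn_addl !(sgnC i). Qed.
End Signs.

Definition signE := (mulnDl, mulnDr, exprD, sgnE, sgn_addl, sgn_addr).

(** Each sign becomes a variable s with a hypothesis s * s = 1; the equation is
    then one between polynomials in these variables. *)
Ltac sign_pairs acc :=
  lazymatch goal with
  | |- context [sgn ?K ?i ?j] =>
     let s := fresh in
     pose proof (sgn_sq K i j) as s;
     try rewrite (sgnC K j i);
     generalize dependent (sgn K i j); intros ? s;
     sign_pairs (s, acc)
  | _ => sign_field acc
  end
with sign_field acc :=
  lazymatch acc with
  | tt => field
  | (?a, tt) => field: a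
  | (?a, (?b, tt)) => field: a b
  | (?a, (?b, (?c, tt))) => field: a b c
  | (?a, (?b, (?c, (?d, tt)))) => field: a b c d
  | (?a, (?b, (?c, (?d, (?e, tt))))) => field: a b c d e
  | (?a, (?b, (?c, (?d, (?e, (?f, tt)))))) => field: a b c d e f
  | (?a, (?b, (?c, (?d, (?e, (?f, (?g, tt))))))) => field: a b c d e f g
  | (?a, (?b, (?c, (?d, (?e, (?f, (?g, (?h, tt)))))))) => field: a b c d e f g h
  end.

Ltac lmod_reflect :=
  match goal with
  | |- @eq ?T ?u ?v =>
    let K := match goal with |- context [@GRing.scale ?K _ _ _] => K end in
    let C := match goal with |- context [@GRing.scale _ _ ?c _] => type of c end in
    let env := lin_atoms u (@nil T) in
    let env := lin_atoms v env in
    let e1 := lin_quote C u env in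
    let e2 := lin_quote C v env in
    refine (@leval_same _ _ env e1 e2 _);
    cbn [lsame lcoef oval oadd omapr size Nat.eqb]; repeat split
  end.

Ltac lmod := lmod_reflect; rewrite ?signE; sign_pairs tt; try done.

(** * Linear and bilinear maps *)

Lemma bilinearI (K : fieldType) (U V W : lmodType K) (f : U -> V -> W) :
    (forall c u u' v, f (c *: u + u') v = c *: f u v + f u' v) ->
    (forall c u v v', f u (c *: v + v') = c *: f u v + f u v') ->
  bilinear_for *:%R *:%R f.
Proof. by move=> fl fr; split=> [v c u u'|u c v v'] /=. Qed.

Section Bilinear.
Context (K : fieldType) (U V W : lmodType K) (f : {bilinear U -> V -> W}).

Lemma bil0l v : f 0 v = 0. Proof. exact: linear0l. Qed.
Lemma bil0r u : f u 0 = 0. Proof. exact: linear0r. Qed.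
Lemma bilNl u v : f (- u) v = - f u v. Proof. exact: linearNl. Qed.
Lemma bilNr u v : f u (- v) = - f u v. Proof. exact: linearNr. Qed.
Lemma bilDl u u' v : f (u + u') v = f u v + f u' v. Proof. exact: linearDl. Qed.
Lemma bilDr u v v' : f u (v + v') = f u v + f u v'. Proof. exact: linearDr. Qed.
Lemma bilZl c u v : f (c *: u) v = c *: f u v. Proof. exact: linearZl_LR. Qed.
Lemma bilZr c u v : f u (c *: v) = c *: f u v. Proof. exact: linearZr_LR. Qed.
End Bilinear.

(** The proof that a combination of hypotheses vanishes is built like a list:
    lincombD adds a term and lincomb0 ends it. *)
Section LinearCombination.
Context (K : fieldType) (V : lmodType K).

Lemma lincomb0 : 0 = 0 :> V.
Proof. by []. Qed.

Lemma lincombD (c : K) (u w : V) : u = 0 -> w = 0 -> c *: u + w = 0.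
Proof. by move=> -> ->; rewrite scaler0 addr0. Qed.

Lemma eq_of_lincomb (u v w : V) : w = 0 -> u - v = w -> u = v.
Proof. by move=> -> /eqP; rewrite subr_eq0 => /eqP. Qed.
End LinearCombination.

Section LinearMap.
Context (K : fieldType) (U V : lmodType K) (f : {linear U -> V}).

Lemma lin0 : f 0 = 0. Proof. exact: raddf0. Qed.
Lemma linN u : f (- u) = - f u. Proof. exact: raddfN. Qed.
Lemma linD u v : f (u + v) = f u + f v. Proof. exact: raddfD. Qed.
Lemma linZ c u : f (c *: u) = c *: f u. Proof. exact: linearZ_LR. Qed.
End LinearMap.

Definition linE K U V f := (@lin0 K U V f, @linN K U V f, @linD K U V f, @linZ K U V f).

Definition bilE_for K U V W f := (@bil0l K U V W f, @bil0r K U V W f,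
  @bilNl K U V W f, @bilNr K U V W f, @bilDl K U V W f, @bilDr K U V W f,
  @bilZl K U V W f, @bilZr K U V W f).
Definition bilE := (bil0l, bil0r, bilNl, bilNr, bilDl, bilDr, bilZl, bilZr).

(** * Maps out of spans, quotients and tensor products *)

Section SpanQuotient.
Context (K : nzRingType) (V : lmodType K) (S : set V).

Lemma span_ind (P : V -> Prop) :
    P 0 -> (forall c u v, S u -> P v -> P (c *: u + v)) ->
  forall v, span S v -> P v.
Proof.
move=> P0 PS v [n [c [x [Sx ->]]]]; elim/big_rec: _ => // i u _ Pu.
exact: PS.
Qed.

Lemma span0 : span S 0.
Proof. by apply/asboolP; have [] := in_span_submod_closed S. Qed.

Lemma spanP c u v : span S u -> span S v -> span S (c *: u + v).
Proof.
move=> Su Sv; have [_ SP] := in_span_submod_closed S.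
by apply/asboolP/SP; apply/asboolP.
Qed.

Lemma quot_class0 v : quot_class S v = 0 <-> span S v.
Proof.
have -> : 0 = quot_class S 0 by rewrite raddf0.
by rewrite quot_classP subr0.
Qed.

(** This is the universal property of the quotient: a linear map that vanishes
    on S does not depend on the representative chosen in a class. *)
Lemma quot_repr (W : lmodType K) (f : {linear V -> W}) v :
  (forall u, S u -> f u = 0) -> f (repr (quot_class S v)) = f v.
Proof.
move=> fS; apply/eqP; rewrite -subr_eq0 -linearB; apply/eqP.
have /quot_classP : quot_class S (repr (quot_class S v)) = quot_class S v.
  exact: quot_classK.
elim/span_ind=> [|c u w /fS fu fw]; first exact: linear0.
by rewrite linearP /= fu fw scaler0 addr0.
Qed.

End SpanQuotient.

Section LinearPredicate.
Context (K : fieldType).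
Implicit Types U V W : lmodType K.

Lemma linear_compose U V W (f : V -> W) (g : U -> V) :
  linear f -> linear g -> linear (fun x => f (g x)).
Proof. by move=> lf lg c x y; rewrite lg lf. Qed.

Lemma linear_addf V W (f g : V -> W) :
  linear f -> linear g -> linear (fun x => f x + g x).
Proof. by move=> lf lg c x y; rewrite lf lg scalerDr addrACA. Qed.

Lemma linear_scalef V W (k : K) (f : V -> W) :
  linear f -> linear (fun x => k *: f x).
Proof. by move=> lf c x y; rewrite lf scalerDr !scalerA mulrC. Qed.

Lemma linear_at0 V W (f : V -> W) : linear f -> f 0 = 0.
Proof. by move=> lf; have := lf (-1) 0 0; rewrite !scaleN1r !addNr. Qed.

Lemma linear_scale V W (f : V -> W) : linear f -> forall c x, f (c *: x) = c *: f x.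
Proof. by move=> lf c x; have := lf c x 0; rewrite (linear_at0 lf) !addr0. Qed.

Lemma linear_add V W (f : V -> W) : linear f -> forall x y, f (x + y) = f x + f y.
Proof. by move=> lf x y; have := lf 1 x y; rewrite !scale1r. Qed.

Lemma span_linear_ext V W (S : set V) (f g : V -> W) :
  linear f -> linear g -> (forall x, S x -> f x = g x) ->
  forall x, span S x -> f x = g x.
Proof.
move=> lf lg fg; apply: span_ind => [|c x y Sx IH].
  by rewrite !linear_at0.
by rewrite lf lg fg // IH.
Qed.

End LinearPredicate.

Section TensorLift.
Context (K : fieldType) (U V : lmodType K).

Section Lift.
Context (W : lmodType K) (h : {bilinear U -> V -> W}).

Let lift (D : {freeg (U * V)%type / K}) : W := fglift (fun z => h z.1 z.2) D.

Let liftB : {morph lift : D E / D - E}.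
Proof. exact: lift_is_additive. Qed.

Let liftD : {morph lift : D E / D + E}.
Proof.
by move=> D E; rewrite -{1}[E]opprK liftB -[- E]sub0r !liftB -[0]subr0 liftB subrr sub0r opprK.
Qed.

Let liftZ : scalable lift.
Proof.
move=> c; elim/freeg_ind_dom0 => [|k x D _ _ IH].
  by rewrite scaler0 -[0]subr0 liftB subrr scaler0.
have -> : c *: (<< k *g x >> + D) = << c * k *g x >> + c *: D.
  by rewrite scalerDr; congr (_ + _); apply/eqP/freeg_eqP => y; rewrite ?coeffZ ?coeffU ?mulrA.
by rewrite !liftD IH /lift !liftU scalerDr scalerA.
Qed.

Let lift_linear : linear lift.
Proof. by move=> c D E; rewrite liftD liftZ. Qed.
HB.instance Definition _ :=
  GRing.isLinear.Build K {freeg (U * V)%type / K} W *:%R lift lift_linear.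

Definition tens_lift (x : tensor U V) : W := lift (repr x).

Let lift_rel D : tensor_rel D -> lift D = 0.
Proof.
by case=> *; rewrite !(liftB, liftD, liftZ) /lift !liftU /= !scale1r ?linearPl ?linearPr /= subrr.
Qed.

Fact tens_lift_linear : linear tens_lift.
Proof.
move=> c x y; rewrite -(quot_classK x) -(quot_classK y) -linearP /tens_lift.
by rewrite !(quot_repr (f := lift)) ?linearP //; exact: lift_rel.
Qed.
HB.instance Definition _ :=
  GRing.isLinear.Build K (tensor U V) W *:%R tens_lift tens_lift_linear.

Lemma tens_liftE u v : tens_lift (tens u v) = h u v.
Proof.
rewrite /tens_lift (quot_repr (f := lift)); last exact: lift_rel.
by rewrite /= /lift liftU scale1r.
Qed.
End Lift.

Lemma tens_ind (P : tensor U V -> Prop) :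
    P 0 -> (forall c x y, P x -> P y -> P (c *: x + y)) ->
    (forall u v, P (tens u v)) ->
  forall x, P x.
Proof.
move=> P0 PD Pt x; rewrite -(quot_classK x); elim/freeg_ind_dom0: (repr x).
  by rewrite raddf0.
move=> k [u v] D _ _ PD'.
have -> : << k *g (u, v) >> = k *: << (u, v) >> :> {freeg (U * V)%type / K}.
  by apply/eqP/freeg_eqP => y; rewrite ?coeffZ !coeffU mulrCA mul1r mulrC.
by rewrite linearP; apply: PD => //; apply: Pt.
Qed.

End TensorLift.

(** For a bilinear map given as a plain constant: rewriting with rules headed by
    that constant is much faster than unifying it with a generic bilinear
    map. *)
Lemma bilinear_rules (K : fieldType) (U V W : lmodType K) (f : U -> V -> W) :
    bilinear_for *:%R *:%R f ->
  (forall v, f 0 v = 0)%R * (forall u, f u 0 = 0)%R *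
  (forall u v, f (- u) v = - f u v)%R * (forall u v, f u (- v) = - f u v)%R *
  (forall u u' v, f (u + u') v = f u v + f u' v)%R *
  (forall u v v', f u (v + v') = f u v + f u v')%R *
  (forall c u v, f (c *: u) v = c *: f u v)%R *
  (forall c u v, f u (c *: v) = c *: f u v)%R.
Proof.
move=> fP; pose F : {bilinear U -> V -> W} := HB.pack f
  (@bilinear_isBilinear.Build K U V W *:%R *:%R f fP).
by do !split=> *; rewrite -[f]/(F : U -> V -> W) ?bilE.
Qed.

(** * The operators <a, b> and \partial_(m, n) are derivations *)

Section InnerOperators.
Context (K : numFieldType) (T : jternary K).
Local Notation J := (jtJ T).
Local Notation M := (jtM T).
Local Notation dot := (dot T).
Local Notation bul := (bul T).
Local Notation star := (star T).
Local Notation tri := (@tri K T).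
Implicit Types (i j k l p q : bool) (a b c d : J) (m n r s t : M).

Lemma dot_par i j a b : par i a -> par j b -> par (i (+) j) (dot a b).
Proof. exact: (jordan_even (jt_jordan T)). Qed.
Lemma bul_par i j a m : par i a -> par j m -> par (i (+) j) (bul a m).
Proof. exact: (special_even (jt_special T)). Qed.
Lemma star_par i j m n : par i m -> par j n -> par (i (+) j) (star m n).
Proof. exact: jt_star_even. Qed.
Lemma tri_par i j k m n r : par i m -> par j n -> par k r ->
  par (i (+) j (+) k) (tri m n r).
Proof. exact: jt_tri_even. Qed.

Lemma dotC i j a b : par i a -> par j b -> dot a b = (-1) ^+ (i * j) *: dot b a.
Proof. exact: (jordan_comm (jt_jordan T)). Qed.

Lemma bul_dot i j a b m : par i a -> par j b ->
  bul (dot a b) m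
  = 2^-1 *: (bul a (bul b m) + (-1) ^+ (i * j) *: bul b (bul a m)).
Proof. exact: (special_mul (jt_special T)). Qed.

Fact tri_linear3 m n : linear (tri m n).
Proof. by have [_ _] := jt_tri_linear T. Qed.
Fact tri_linear2 m r : linear (fun n => tri m n r).
Proof. by have [_ + _] := jt_tri_linear T; apply. Qed.
Fact tri_linear1 n r : linear (fun m => tri m n r).
Proof. by have [+ _ _] := jt_tri_linear T; apply. Qed.

Lemma triD1 m m' n r : tri (m + m') n r = tri m n r + tri m' n r.
Proof. exact: (linear_add (tri_linear1 n r)). Qed.
Lemma triD2 m n n' r : tri m (n + n') r = tri m n r + tri m n' r.
Proof. exact: (linear_add (tri_linear2 m r)). Qed.
Lemma triD3 m n r r' : tri m n (r + r') = tri m n r + tri m n r'.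
Proof. exact: (linear_add (tri_linear3 m n)). Qed.
Lemma triZ1 (c : K) m n r : tri (c *: m) n r = c *: tri m n r.
Proof. exact: (linear_scale (tri_linear1 n r)). Qed.
Lemma triZ2 (c : K) m n r : tri m (c *: n) r = c *: tri m n r.
Proof. exact: (linear_scale (tri_linear2 m r)). Qed.
Lemma triZ3 (c : K) m n r : tri m n (c *: r) = c *: tri m n r.
Proof. exact: (linear_scale (tri_linear3 m n)). Qed.
Lemma triN1 m n r : tri (- m) n r = - tri m n r.
Proof. by rewrite -scaleN1r triZ1 scaleN1r. Qed.
Lemma triN2 m n r : tri m (- n) r = - tri m n r.
Proof. by rewrite -scaleN1r triZ2 scaleN1r. Qed.
Lemma triN3 m n r : tri m n (- r) = - tri m n r.
Proof. by rewrite -scaleN1r triZ3 scaleN1r. Qed.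

Definition jtE :=
  (bilE, triD1, triD2, triD3, triZ1, triZ2, triZ3, triN1, triN2, triN3).

(** The left-hand side of the Jordan identity is symmetric in all four arguments,
    the right-hand side only in the first, second and fourth.  So the instances
    with a and with b in the third place have the same left-hand side, and their
    difference is the Leibniz rule. *)
Lemma ldotJ_dot i j k l a b c d :
  par i a -> par j b -> par k c -> par l d ->
  ldotJ i j a b (dot c d) = dot (ldotJ i j a b c) d
    + (-1) ^+ ((i (+) j) * k) *: dot c (ldotJ i j a b d).
Proof.
move=> pa pb pc pd; rewrite /ldotJ !jtE.
have /eqP := jordan_identity (jt_jordan T) pb pc pa pd.
rewrite -subr_eq0 (dotC (dot_par pb pc) (dot_par pa pd)) (dotC pb pa).
rewrite (dotC pc pa) (dotC (dot_par pb pc) pa) !jtE.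
rewrite (dotC (dot_par pb pd) (dot_par pa pc)).
rewrite (dotC (dot_par (dot_par pb pd) pa) pc) (dotC (dot_par pb pd) pa).
rewrite (dotC (dot_par (dot_par pc pd) pa) pb) (dotC (dot_par pc pd) pa) !jtE.
move=> /eqP H1.
have /eqP := jordan_identity (jt_jordan T) pa pc pb pd.
rewrite -subr_eq0 (dotC pc pb) (dotC (dot_par pa pc) pb) !jtE.
rewrite (dotC (dot_par (dot_par pa pd) pb) pc) (dotC (dot_par pa pd) pb).
rewrite (dotC (dot_par (dot_par pc pd) pb) pa) (dotC (dot_par pc pd) pb) !jtE.
move=> /eqP H2.
apply: (eq_of_lincomb (lincombD ((-1) ^+ (i * j + i * k)) H1
                                (lincombD (- (-1) ^+ (j * k)) H2 (lincomb0 _)))).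
lmod.
Qed.

(** Let A, B, C be the operators by which a, b, c act on M.  As a product acts by
    X o Y = (X Y + Y X) / 2, this is the associative identity
    [[A, B], C] = 4 (A o (B o C) - B o (A o C)). *)
Lemma ldotM_bul i j k a b c m :
  par i a -> par j b -> par k c ->
  ldotM i j a b (bul c m) = bul (ldotJ i j a b c) m
    + (-1) ^+ ((i (+) j) * k) *: bul c (ldotM i j a b m).
Proof.
move=> pa pb pc; rewrite /ldotJ /ldotM.
rewrite !jtE.
rewrite (bul_dot _ pa (dot_par pb pc)) (bul_dot _ pb (dot_par pa pc)).
rewrite !(bul_dot _ pa pc, bul_dot _ pb pc).
rewrite !jtE.
lmod. 
Qed.

Lemma ldotJ_star i j k l a b m n :
  par i a -> par j b -> par k m -> par l n ->
  ldotJ i j a b (star m n) = star (ldotM i j a b m) n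
    + (-1) ^+ ((i (+) j) * k) *: star m (ldotM i j a b n).
Proof.
move=> pa pb pm pn; rewrite /ldotJ /ldotM.
rewrite (SJT1 pa pm pn) (SJT1 pb pm pn) !jtE.
rewrite (SJT1 pa pm (bul_par pb pn)) (SJT1 pb pm (bul_par pa pn)).
rewrite (SJT1 pa (bul_par pb pm) pn) (SJT1 pb (bul_par pa pm) pn).
lmod.
Qed.

(** Read backwards, SJT4 says that the product with m * n is the
    antisymmetrization of (m, n, _); so \partial_(m, n) is minus the
    symmetrization, and only triple products remain. *)
Lemma bul_star i j k m n r : par i m -> par j n -> par k r ->
  bul (star m n) r = tri m n r - (-1) ^+ (i * j) *: tri n m r.
Proof. by move=> pm pn pr; rewrite (SJT4 pm pn pr) addrAC subrr add0r. Qed.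

Lemma ldotM_tri i j k l q a b m n r :
  par i a -> par j b -> par k m -> par l n -> par q r ->
  ldotM i j a b (tri m n r) = tri (ldotM i j a b m) n r
    + (-1) ^+ ((i (+) j) * k) *: tri m (ldotM i j a b n) r
    + (-1) ^+ ((i (+) j) * (k + l)) *: tri m n (ldotM i j a b r).
Proof.
move=> pa pb pm pn pr; rewrite /ldotM.
rewrite (SJT2 pa pm pn pr) (SJT2 pb pm pn pr) !jtE.
rewrite (SJT2 pa (bul_par pb pm) pn pr) (SJT2 pb (bul_par pa pm) pn pr).
rewrite (SJT2 pa pm (bul_par pb pn) pr) (SJT2 pb pm (bul_par pa pn) pr).
rewrite (SJT2 pa pm pn (bul_par pb pr)) (SJT2 pb pm pn (bul_par pa pr)).
lmod.
Qed.

Lemma partJ_dot i j k l m n a b :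
  par i m -> par j n -> par k a -> par l b ->
  partJ i j m n (dot a b) = dot (partJ i j m n a) b
    + (-1) ^+ ((i (+) j) * k) *: dot a (partJ i j m n b).
Proof.
move=> pm pn pa pb.
rewrite (partJE _ _ _ _ (dot_par pa pb)) (partJE _ _ _ _ pa) (partJE _ _ _ _ pb).
rewrite !(bul_dot _ pa pb) !jtE.
rewrite (dotC (star_par (bul_par pa pm) pn) pb).
rewrite (dotC (star_par pm (bul_par pa pn)) pb).
rewrite (SJT1 pa (bul_par pb pm) pn) (SJT1 pb (bul_par pa pm) pn).
rewrite (SJT1 pa pm (bul_par pb pn)) (SJT1 pb pm (bul_par pa pn)).
lmod.
Qed.

(** Once every (x * y) . z is replaced by triple products, only SJT2 is
    needed. *)
Lemma partM_bul i j k l m n a r :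
  par i m -> par j n -> par k a -> par l r ->
  partM m n (bul a r) = bul (partJ i j m n a) r
    + (-1) ^+ ((i (+) j) * k) *: bul a (partM m n r).
Proof.
move=> pm pn pa pr; rewrite (partJE _ _ _ _ pa) /partM !jtE.
rewrite (bul_star (bul_par pa pm) pn pr) (bul_star pm (bul_par pa pn) pr).
rewrite (bul_star pm pn (bul_par pa pr)) (bul_star pm pn pr) !jtE.
rewrite (SJT2 pa pm pn pr) (SJT2 pa pn pm pr).
lmod.
Qed.

(** The product of m * n and r * s is expanded by SJT1 in two ways, through the
    action of m * n and through that of r * s; SJT5 accounts for the rest. *)
Lemma partJ_star i j k l m n r s :
  par i m -> par j n -> par k r -> par l s ->
  partJ i j m n (star r s) = star (partM m n r) s
    + (-1) ^+ ((i (+) j) * k) *: star r (partM m n s).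
Proof.
move=> pm pn pr ps.
rewrite (partJE _ _ _ _ (star_par pr ps)) /partM !jtE.
have /eqP := SJT5 pm pn pr ps; rewrite -subr_eq0 => /eqP H5.
have /eqP := dotC (star_par pm pn) (star_par pr ps).
rewrite (SJT1 (star_par pm pn) pr ps) (SJT1 (star_par pr ps) pm pn).
rewrite -subr_eq0 => /eqP H1.
apply: (eq_of_lincomb (lincombD (-1) H1 (lincombD 1 H5 (lincomb0 _)))).
lmod.
Qed.

(** SJT6 is the Leibniz rule for (m, n, _), except that (n, m, _) occurs in
    the middle slot; SJT4 and half of SJT2 for m * n restore the symmetry. *)
Lemma partM_tri i j k l q m n r s t :
  par i m -> par j n -> par k r -> par l s -> par q t ->
  partM m n (tri r s t) = tri (partM m n r) s t
    + (-1) ^+ ((i (+) j) * k) *: tri r (partM m n s) t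
    + (-1) ^+ ((i (+) j) * (k + l)) *: tri r s (partM m n t).
Proof.
move=> pm pn pr ps pt; rewrite /partM !jtE.
rewrite (SJT2 (star_par pm pn) pr ps pt) (SJT6 pm pn pr ps pt).
rewrite (bul_star pm pn ps) !jtE.
lmod.
Qed.

(** An endomorphism of the pair is given by its restrictions f to J and g to M.
    Homogeneity is required of every argument, as the signs depend on it. *)
Record is_derivation p (f : {linear J -> J}) (g : {linear M -> M}) : Prop :=
  IsDerivation {
  derJ_par : forall i a, par i a -> par (p (+) i) (f a);
  derM_par : forall i m, par i m -> par (p (+) i) (g m);
  der_dot : forall i j a b, par i a -> par j b ->
    f (dot a b) = dot (f a) b + (-1) ^+ (p * i) *: dot a (f b);
  der_bul : forall i j a m, par i a -> par j m ->
    g (bul a m) = bul (f a) m + (-1) ^+ (p * i) *: bul a (g m);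
  der_star : forall i j m n, par i m -> par j n ->
    f (star m n) = star (g m) n + (-1) ^+ (p * i) *: star m (g n);
  der_tri : forall i j k m n r, par i m -> par j n -> par k r ->
    g (tri m n r) = tri (g m) n r + (-1) ^+ (p * i) *: tri m (g n) r
      + (-1) ^+ (p * (i + j)) *: tri m n (g r)
}.

Lemma parD (V : superspace K) i (u v : V) : par i u -> par i v -> par i (u + v).
Proof.
by move=> pu pv; rewrite -[u]scale1r; apply: (parP (par_superspace V)).
Qed.

Lemma parZ (V : superspace K) i (c : K) (u : V) : par i u -> par i (c *: u).
Proof.
move=> pu; rewrite -[c *: u]addr0; apply: (parP (par_superspace V)) => //.
exact: (par0 (par_superspace V)).
Qed.

Lemma parN (V : superspace K) i (u : V) : par i u -> par i (- u).
Proof. by rewrite -scaleN1r; apply: parZ. Qed.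

Lemma ldot_derivation i j a b : par i a -> par j b ->
  is_derivation (i (+) j) (ldotJ i j a b) (ldotM i j a b).
Proof.
move=> pa pb; split.
- move=> k c pc; apply: parD; first by rewrite -addbA; do !apply: dot_par.
  by apply/parN/parZ; rewrite (addbC i) -addbA; do !apply: dot_par.
- move=> k m pm; apply/parZ/parD; first by rewrite -addbA; do !apply: bul_par.
  by apply/parN/parZ; rewrite (addbC i) -addbA; do !apply: bul_par.
- by move=> k l c d pc pd; apply: (ldotJ_dot pa pb pc pd).
- by move=> k l c m pc pm; apply: (ldotM_bul _ pa pb pc).
- by move=> k l m n pm pn; apply: (ldotJ_star pa pb pm pn).
- by move=> k l q m n r pm pn pr; apply: (ldotM_tri pa pb pm pn pr).
Qed.

Lemma part_derivation i j m n : par i m -> par j n ->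
  is_derivation (i (+) j) (partJ i j m n) (partM m n).
Proof.
move=> pm pn; split.
- move=> k a pa; rewrite /= (partJE _ _ _ _ pa); apply/parZ/parD.
    apply: parZ; rewrite addbC addbA; apply: star_par => //; exact: bul_par.
  by apply/parN/parZ; rewrite -addbA (addbC j); apply: star_par => //; apply: bul_par.
- move=> k r pr; apply: parD; first by apply/parZ/bul_par => //; apply: star_par.
  by apply/parN/tri_par.
- by move=> k l a b pa pb; apply: (partJ_dot pm pn pa pb).
- by move=> k l a r pa pr; apply: (partM_bul pm pn pa pr).
- by move=> k l r s pr ps; apply: (partJ_star pm pn pr ps).
- by move=> k l q r s t pr ps pt; apply: (partM_tri pm pn pr ps pt).
Qed.

Lemma partM_par i j k m n r : par i m -> par j n -> par k r ->
  par (i (+) j (+) k) (partM m n r).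
Proof. by move=> pm pn pr; apply: (derM_par (part_derivation pm pn) pr). Qed.

Section Derivation.
Context (p : bool) (f : {linear J -> J}) (g : {linear M -> M}).
Context (fg : is_derivation p f g).

Lemma der_ldotJ i j k a b c : par i a -> par j b -> par k c ->
  f (ldotJ i j a b c)
  = ldotJ (p (+) i) j (f a) b c + (-1) ^+ (p * i) *: ldotJ i (p (+) j) a (f b) c
    + (-1) ^+ (p * (i + j)) *: ldotJ i j a b (f c).
Proof.
move=> pa pb pc; rewrite /ldotJ !(linE f).
rewrite (der_dot fg pa (dot_par pb pc)) (der_dot fg pb (dot_par pa pc)).
rewrite (der_dot fg pa pc) (der_dot fg pb pc) !jtE.
lmod.
Qed.

Lemma der_ldotM i j k a b m : par i a -> par j b -> par k m ->
  g (ldotM i j a b m)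
  = ldotM (p (+) i) j (f a) b m + (-1) ^+ (p * i) *: ldotM i (p (+) j) a (f b) m
    + (-1) ^+ (p * (i + j)) *: ldotM i j a b (g m).
Proof.
move=> pa pb pm; rewrite /ldotM !(linE g).
rewrite (der_bul fg pa (bul_par pb pm)) (der_bul fg pb (bul_par pa pm)).
rewrite (der_bul fg pa pm) (der_bul fg pb pm) !jtE.
lmod.
Qed.

Lemma der_partJ i j k m n a : par i m -> par j n -> par k a ->
  f (partJ i j m n a)
  = partJ (p (+) i) j (g m) n a + (-1) ^+ (p * i) *: partJ i (p (+) j) m (g n) a
    + (-1) ^+ (p * (i + j)) *: partJ i j m n (f a).
Proof.
move=> pm pn pa; rewrite !(partJE _ _ _ _ pa) (partJE _ _ _ _ (derJ_par fg pa)).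
rewrite !(linE f) (der_star fg (bul_par pa pm) pn) (der_star fg pm (bul_par pa pn)).
rewrite (der_bul fg pa pm) (der_bul fg pa pn) !jtE.
lmod.
Qed.

Lemma der_partM i j k m n r : par i m -> par j n -> par k r ->
  g (partM m n r)
  = partM (g m) n r + (-1) ^+ (p * i) *: partM m (g n) r
    + (-1) ^+ (p * (i + j)) *: partM m n (g r).
Proof.
move=> pm pn pr; rewrite /partM !(linE g) (der_bul fg (star_par pm pn) pr).
rewrite (der_star fg pm pn) (der_tri fg pm pn pr) !jtE.
lmod.
Qed.

End Derivation.

Lemma ldotJ_anti i j a b c : ldotJ i j a b c = - (-1) ^+ (i * j) *: ldotJ j i b a c.
Proof. rewrite /ldotJ. lmod. Qed.

Lemma ldotM_anti i j a b m : ldotM i j a b m = - (-1) ^+ (i * j) *: ldotM j i b a m.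
Proof. rewrite /ldotM. lmod. Qed.

Lemma partJ_sym i j k m n a : par i m -> par j n -> par k a ->
  partJ i j m n a = (-1) ^+ (i * j) *: partJ j i n m a.
Proof.
move=> pm pn pa; rewrite !(partJE _ _ _ _ pa).
rewrite (jt_star_anticomm (bul_par pa pm) pn) (jt_star_anticomm pm (bul_par pa pn)).
lmod.
Qed.

Lemma partM_sym i j k m n r : par i m -> par j n -> par k r ->
  partM m n r = (-1) ^+ (i * j) *: partM n m r.
Proof.
move=> pm pn pr; rewrite /partM (bul_star pm pn pr) (bul_star pn pm pr).
lmod.
Qed.

(** The Jordan identity with its third and fourth arguments exchanged. *)
Lemma ldotJ_cycle i j k l a b c d :
  par i a -> par j b -> par k c -> par l d ->
  (-1) ^+ (i * k) *: ldotJ (i (+) j) k (dot a b) c d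
  + (-1) ^+ (i * j) *: ldotJ (j (+) k) i (dot b c) a d
  + (-1) ^+ (j * k) *: ldotJ (k (+) i) j (dot c a) b d = 0.
Proof.
move=> pa pb pc pd; rewrite /ldotJ.
have /eqP := jordan_identity (jt_jordan T) pa pb pd pc.
rewrite -subr_eq0 (dotC pd pc) (dotC (dot_par pa pd) (dot_par pb pc)).
rewrite (dotC (dot_par (dot_par pa pb) pd) pc).
rewrite (dotC (dot_par (dot_par pa pc) pd) pb).
rewrite (dotC (dot_par (dot_par pb pc) pd) pa) (dotC pa pc) !jtE => /eqP H.
apply: (eq_of_lincomb (lincombD ((-1) ^+ (i * k + k * l)) H (lincomb0 _))).
lmod.
Qed.

Lemma ldotM_cycle i j k a b c m :
  par i a -> par j b -> par k c ->
  (-1) ^+ (i * k) *: ldotM (i (+) j) k (dot a b) c m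
  + (-1) ^+ (i * j) *: ldotM (j (+) k) i (dot b c) a m
  + (-1) ^+ (j * k) *: ldotM (k (+) i) j (dot c a) b m = 0.
Proof.
move=> pa pb pc; rewrite /ldotM.
rewrite !(bul_dot _ pa pb, bul_dot _ pb pc, bul_dot _ pc pa) !jtE.
lmod.
Qed.

Lemma partJ_bul p i j k a m n b :
  par p a -> par i m -> par j n -> par k b ->
  partJ (p (+) i) j (bul a m) n b
  = (-1) ^+ (p * i) *: partJ i (p (+) j) m (bul a n) b
  + (-1) ^+ (p * (i + j)) *: (2 *: ldotJ (i (+) j) p (star m n) a b).
Proof.
move=> pa pm pn pb; rewrite !(partJE _ _ _ _ pb) /ldotJ.
rewrite (dotC (star_par pm pn) (dot_par pa pb)) (dotC (star_par pm pn) pb) !jtE.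
rewrite (SJT1 (dot_par pa pb) pm pn) (SJT1 pb pm pn) !jtE.
rewrite (SJT1 pa (bul_par pb pm) pn) (SJT1 pa pm (bul_par pb pn)).
rewrite !(bul_dot _ pa pb) !jtE.
lmod.
Qed.

Lemma partM_bul_left p i j k a m n r :
  par p a -> par i m -> par j n -> par k r ->
  partM (bul a m) n r
  = (-1) ^+ (p * i) *: partM m (bul a n) r
  + (-1) ^+ (p * (i + j)) *: (2 *: ldotM (i (+) j) p (star m n) a r).
Proof.
move=> pa pm pn pr; rewrite /partM /ldotM.
rewrite (bul_star (bul_par pa pm) pn pr) (bul_star pm (bul_par pa pn) pr).
rewrite (bul_star pm pn (bul_par pa pr)) (bul_star pm pn pr) !jtE.
rewrite (SJT2 pa pm pn pr) (SJT2 pa pn pm pr).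
lmod.
Qed.

End InnerOperators.

(** * The superspace J (x) J (+) M (x) M and its quotient B^s *)

Section HomogeneousExtension.
Context (K : fieldType) (U V : superspace K) (W : lmodType K).
Context (h : bool -> bool -> {bilinear U -> V -> W}).

(** A formula that depends on the parities of its arguments defines a bilinear
    map on homogeneous vectors; it is extended by adding its values on the
    homogeneous parts. *)
Definition hom_extension (u : U) (v : V) : W :=
  h false false (hpart false u) (hpart false v)
  + h false true (hpart false u) (hpart true v)
  + h true false (hpart true u) (hpart false v)
  + h true true (hpart true u) (hpart true v).

Fact hom_extension_bilinear : bilinear_for *:%R *:%R hom_extension.
Proof.
apply: bilinearI => *; rewrite /hom_extension !hpart_linear !bilE; lmod.
Qed.
HB.instance Definition _ :=
  bilinear_isBilinear.Build K U V W *:%R *:%R hom_extension hom_extension_bilinear.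

Lemma hpart_id (X : superspace K) i (x : X) : par i x -> hpart i x = x.
Proof.
by move=> px; apply: hpart_uniq => //; rewrite subrr; apply: (par0 (par_superspace X)).
Qed.

Lemma hpart_neg (X : superspace K) i (x : X) : par i x -> hpart (~~ i) x = 0.
Proof.
move=> px; apply: hpart_uniq; first exact: (par0 (par_superspace X)).
by rewrite subr0 negbK.
Qed.

Lemma hom_extensionE i j u v : par i u -> par j v -> hom_extension u v = h i j u v.
Proof.
move=> pu pv; rewrite /hom_extension.
have [eu eu'] := (hpart_id pu, hpart_neg pu).
have [ev ev'] := (hpart_id pv, hpart_neg pv).
by case: i j pu pv eu eu' ev ev' => [] [] _ _ /= -> -> -> ->;
  rewrite !bilE ?(add0r, addr0).
Qed.
End HomogeneousExtension.

Section LiftJJMM.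
Context (K : fieldType) (T : jternary K) (W : lmodType K).
Context (hJ : {bilinear jtJ T -> jtJ T -> W}) (hM : {bilinear jtM T -> jtM T -> W}).

Definition JJMM_lift (x : JJMM T) : W := tens_lift hJ x.1 + tens_lift hM x.2.

Fact JJMM_lift_linear : linear JJMM_lift.
Proof. by move=> c x y; rewrite /JJMM_lift !linearP /= scalerDr addrACA. Qed.
HB.instance Definition _ :=
  GRing.isLinear.Build K (JJMM T) W *:%R JJMM_lift JJMM_lift_linear.

Lemma JJMM_liftJ a b : JJMM_lift (tensJ a b) = hJ a b.
Proof. by rewrite /JJMM_lift /= tens_liftE linear0 addr0. Qed.

Lemma JJMM_liftM m n : JJMM_lift (tensM m n) = hM m n.
Proof. by rewrite /JJMM_lift /= tens_liftE linear0 add0r. Qed.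
End LiftJJMM.

Section Classes.
Context (K : numFieldType) (T : jternary K).
Local Notation J := (jtJ T).
Local Notation M := (jtM T).
Local Notation JM := (J * M)%type.
Local Notation End := {linear JM -> JM}.
Local Notation dot := (dot T).
Local Notation bul := (bul T).
Local Notation star := (star T).
Local Notation classJ := (@classJ K T).
Local Notation classM := (@classM K T).
Implicit Types (i j k l p q : bool) (a b c d : J) (m n r s t : M).

Fact tensJ_bilinear : bilinear_for *:%R *:%R (@tensJ K T).
Proof.
apply: bilinearI => *; rewrite /tensJ ?linearPl ?linearPr /=;
  by congr pair; rewrite /= scaler0 addr0.
Qed.
HB.instance Definition _ := bilinear_isBilinear.Build K J J (JJMM T)
  *:%R *:%R (@tensJ K T) tensJ_bilinear.

Fact tensM_bilinear : bilinear_for *:%R *:%R (@tensM K T).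
Proof.
apply: bilinearI => *; rewrite /tensM ?linearPl ?linearPr /=;
  by congr pair; rewrite /= scaler0 addr0.
Qed.
HB.instance Definition _ := bilinear_isBilinear.Build K M M (JJMM T)
  *:%R *:%R (@tensM K T) tensM_bilinear.

Fact classJ_bilinear : bilinear_for *:%R *:%R classJ.
Proof.
by apply: bilinearI => *; rewrite /classJ !(bilDl, bilDr, bilZl, bilZr) linearP.
Qed.
HB.instance Definition _ := bilinear_isBilinear.Build K J J (Bs T)
  *:%R *:%R classJ classJ_bilinear.

Fact classM_bilinear : bilinear_for *:%R *:%R classM.
Proof.
by apply: bilinearI => *; rewrite /classM !(bilDl, bilDr, bilZl, bilZr) linearP.
Qed.
HB.instance Definition _ := bilinear_isBilinear.Build K M M (Bs T)
  *:%R *:%R classM classM_bilinear.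

Definition classJE := bilinear_rules classJ_bilinear.
Definition classME := bilinear_rules classM_bilinear.
Definition classE := (classJE, classME).

Lemma class_rel x : Rs_gen x -> Bs_class x = 0 :> Bs T.
Proof. by move=> Rx; apply/quot_class0/spanS. Qed.

Definition BclassE := (linE (@Bs_class K T)).

Lemma classJ_anti i j a b : par i a -> par j b ->
  classJ a b + (-1) ^+ (i * j) *: classJ b a = 0.
Proof. by move=> pa pb; have := class_rel (Rs_dot pa pb); rewrite !BclassE. Qed.

Lemma classM_sym i j m n : par i m -> par j n ->
  classM m n - (-1) ^+ (i * j) *: classM n m = 0.
Proof. by move=> pm pn; have := class_rel (Rs_tens pm pn); rewrite !BclassE. Qed.

Lemma classJ_cycle i j k a b c : par i a -> par j b -> par k c ->
  (-1) ^+ (i * k) *: classJ (dot a b) c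
  + (-1) ^+ (i * j) *: classJ (dot b c) a
  + (-1) ^+ (j * k) *: classJ (dot c a) b = 0.
Proof.
by move=> pa pb pc; have := class_rel (Rs_cycle pa pb pc); rewrite !BclassE.
Qed.

Lemma classM_bul p i j a m n : par p a -> par i m -> par j n ->
  classM (bul a m) n - (-1) ^+ (p * i) *: classM m (bul a n)
  - (-1) ^+ (p * (i + j)) *: (2 *: classJ (star m n) a) = 0.
Proof.
by move=> pa pm pn; have := class_rel (Rs_bul pa pm pn); rewrite !BclassE.
Qed.

Lemma classM_part i j k l m n r s :
  par i m -> par j n -> par k r -> par l s ->
  classM (partM m n r) s + (-1) ^+ ((i + j) * k) *: classM r (partM m n s)
  + (-1) ^+ ((i + j) * (k + l)) *: classM (partM r s m) n
  + (-1) ^+ ((k + l) * j) *: classM m (partM r s n) = 0.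
Proof.
by move=> pm pn pr ps; have := class_rel (Rs_part pm pn pr ps); rewrite !BclassE.
Qed.

Lemma superspace_ind (V : superspace K) (P : V -> Prop) :
  (forall u v, P u -> P v -> P (u + v)) -> (forall i v, par i v -> P v) ->
  forall v, P v.
Proof.
move=> PD Ph v; have [u [w [pu pw ->]]] := par_sum (par_superspace V) v.
by apply: PD; [apply: Ph pu|apply: Ph pw].
Qed.

Lemma JJMM_ind (P : JJMM T -> Prop) :
    P 0 -> (forall (c : K) x y, P x -> P y -> P (c *: x + y)) ->
    (forall i j a b, par i a -> par j b -> P (tensJ a b)) ->
    (forall i j m n, par i m -> par j n -> P (tensM m n)) ->
  forall x, P x.
Proof.
move=> P0 PP PJ PM [tJ tM]; have PD y z : P y -> P z -> P (y + z).
  by move=> Py Pz; rewrite -[y]scale1r; apply: PP.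
have -> : (tJ, tM) = (tJ, 0) + (0, tM) :> JJMM T.
  by congr pair; rewrite /= ?addr0 ?add0r.
apply: (PD).
  elim/tens_ind: tJ => [//|c tx ty Px Py|a b].
    have -> : (c *: tx + ty, 0) = c *: (tx, 0) + (ty, 0) :> JJMM T.
      by congr pair; rewrite /= scaler0 addr0.
    exact: PP.
  rewrite -/(tensJ a b).
  elim/superspace_ind: a => [a a' Pa Pa'|i a pa]; first by rewrite bilDl; apply: PD.
  elim/superspace_ind: b => [b b' Pb Pb'|j b pb]; first by rewrite bilDr; apply: PD.
  exact: PJ pa pb.
elim/tens_ind: tM => [//|c tx ty Px Py|m n].
  have -> : (0, c *: tx + ty) = c *: (0, tx) + (0, ty) :> JJMM T.
    by congr pair; rewrite /= scaler0 addr0.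
  exact: PP.
rewrite -/(tensM m n).
elim/superspace_ind: m => [m m' Pm Pm'|i m pm]; first by rewrite bilDl; apply: PD.
elim/superspace_ind: n => [n n' Pn Pn'|j n pn]; first by rewrite bilDr; apply: PD.
exact: PM pm pn.
Qed.

Lemma JJMM_lin_ext (W : lmodType K) (k1 : K) (f g h : {linear JJMM T -> W}) :
    (forall a b, f (tensJ a b) = k1 *: g (tensJ a b) + h (tensJ a b)) ->
    (forall m n, f (tensM m n) = k1 *: g (tensM m n) + h (tensM m n)) ->
  forall x, f x = k1 *: g x + h x.
Proof.
move=> eJ eM; elim/JJMM_ind => [|e x y IHx IHy|i j a b _ _|i j m n _ _] //.
  by rewrite !(lin0 f, lin0 g, lin0 h) scaler0 addr0.
rewrite !(linD f, linD g, linD h, linZ f, linZ g, linZ h) IHx IHy; lmod.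
Qed.

Lemma Bs_ind (P : Bs T -> Prop) :
    P 0 -> (forall (c : K) x y, P x -> P y -> P (c *: x + y)) ->
    (forall i j a b, par i a -> par j b -> P (classJ a b)) ->
    (forall i j m n, par i m -> par j n -> P (classM m n)) ->
  forall x, P x.
Proof.
move=> P0 PP PJ PM x; rewrite -(quot_classK x) -[quot_class _ _]/(Bs_class _).
elim/JJMM_ind: (repr x) => [|c y z Py Pz|i j a b pa pb|i j m n pm pn].
- by rewrite lin0.
- by rewrite linD linZ; apply: PP.
- exact: PJ pa pb.
- exact: PM pm pn.
Qed.

Lemma Bs_linear_ext (W : lmodType K) (f g : Bs T -> W) :
    linear f -> linear g ->
    (forall i j a b, par i a -> par j b -> f (classJ a b) = g (classJ a b)) ->
    (forall i j m n, par i m -> par j n -> f (classM m n) = g (classM m n)) ->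
  forall x, f x = g x.
Proof.
move=> lf lg eJ eM; elim/Bs_ind => [|c x y IHx IHy|i j a b|i j m n].
- by rewrite !linear_at0.
- by rewrite lf lg IHx IHy.
- exact: eJ.
- exact: eM.
Qed.

Lemma pair_ext (z w : JM) : z.1 = w.1 -> z.2 = w.2 -> z = w.
Proof. by case: z w => [? ?] [? ?] /= -> ->. Qed.

Lemma JM_ind (P : JM -> Prop) :
  (forall z w, P z -> P w -> P (z + w)) ->
  (forall q a m, par q a -> par q m -> P (a, m)) -> forall z, P z.
Proof.
move=> PD Ph [a m].
have [a0 [a1 [pa0 pa1 ->]]] := par_sum (par_superspace J) a.
have [m0 [m1 [pm0 pm1 ->]]] := par_sum (par_superspace M) m.
rewrite -[(_, _)]/((a0, m0) + (a1, m1)).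
by apply: PD; [apply: Ph pa0 pm0|apply: Ph pa1 pm1].
Qed.

Lemma End_ext (D E : End) :
  (forall q a m, par q a -> par q m -> D (a, m) = E (a, m)) -> D = E.
Proof.
move=> DE; apply: linear_ext; apply: JM_ind => [z w Dz Dw|]; last exact: DE.
by rewrite !linD Dz Dw.
Qed.

Lemma JM_parD q (z w : JM) : JM_par q z -> JM_par q w -> JM_par q (z + w).
Proof. by case=> ? ? [? ?]; split; apply: parD. Qed.

Lemma JM_parZ q (c : K) (z : JM) : JM_par q z -> JM_par q (c *: z).
Proof. by case=> ? ?; split; apply: parZ. Qed.

Lemma EndD (D E : End) z : (D + E) z = D z + E z. Proof. by []. Qed.
Lemma EndN (D : End) z : (- D) z = - D z. Proof. by []. Qed.
Lemma EndZ (c : K) (D : End) z : (c *: D) z = c *: D z. Proof. by []. Qed.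
Lemma End0 z : (0 : End) z = 0. Proof. by []. Qed.
Lemma EndC (D E : End) z : (D \o E : End) z = D (E z). Proof. by []. Qed.
Definition EndE := (EndD, EndN, EndZ, End0, EndC).

Lemma fstD (z w : JM) : (z + w).1 = z.1 + w.1. Proof. by []. Qed.
Lemma fstN (z : JM) : (- z).1 = - z.1. Proof. by []. Qed.
Lemma fstZ (c : K) (z : JM) : (c *: z).1 = c *: z.1. Proof. by []. Qed.
Lemma fst0 : (0 : JM).1 = 0. Proof. by []. Qed.
Lemma sndD (z w : JM) : (z + w).2 = z.2 + w.2. Proof. by []. Qed.
Lemma sndN (z : JM) : (- z).2 = - z.2. Proof. by []. Qed.
Lemma sndZ (c : K) (z : JM) : (c *: z).2 = c *: z.2. Proof. by []. Qed.
Lemma snd0 : (0 : JM).2 = 0. Proof. by []. Qed.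
Definition pairE := (fstD, fstN, fstZ, fst0, sndD, sndN, sndZ, snd0).

(** * Homogeneous parts of endomorphisms *)

Definition grading : End := pair_map (par_sign 1) (par_sign 1).

Lemma gradingE q z : JM_par q z -> grading z = (-1) ^+ q *: z.
Proof.
by case=> pa pm; apply: pair_ext; rewrite /= ?(par_signE _ pa) ?(par_signE _ pm) mul1n.
Qed.

Definition econj (D : End) : End := grading \o D \o grading.

Lemma econjE D z : econj D z = grading (D (grading z)).
Proof. by []. Qed.

Fact econj_linear : linear econj.
Proof.
move=> c D E; apply: linear_ext => z.
by rewrite !(EndE, econjE) !(linE grading).
Qed.

(** The part of D of parity p.  It is locked because comparing two such parts by
    unfolding is very slow. *)
Definition ehom p (D : End) : End :=
  locked (2^-1 *: (D + (-1) ^+ p *: econj D)).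

Lemma ehomK p (D : End) : ehom p D = 2^-1 *: (D + (-1) ^+ p *: econj D).
Proof. by rewrite /ehom -lock. Qed.

Fact ehom_linear p : linear (ehom p).
Proof.
move=> c D E; apply: linear_ext => z.
rewrite !ehomK !(EndE, econjE) !(linE grading); lmod.
Qed.

End Classes.

(** * The action of endomorphisms on B^s *)

Section Action.
Context (K : numFieldType) (T : jternary K).
Local Notation J := (jtJ T).
Local Notation M := (jtM T).
Local Notation JM := (J * M)%type.
Local Notation End := {linear JM -> JM}.
Local Notation classJ := (@classJ K T).
Local Notation classM := (@classM K T).
Implicit Types (i j k l p q : bool) (a b c d : J) (m n r s t : M).

Lemma econj_par p (D : End) : End_par p D -> econj D = (-1) ^+ p *: D.
Proof.
move=> pD; apply: End_ext => q a m pa pm; rewrite econjE EndZ.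
have pz : JM_par q (a, m) by split.
rewrite (gradingE pz) (linZ D) (linZ (grading T)) (gradingE (pD q _ pz)).
rewrite !scalerA; congr (_ *: _).
by case: p {pD} q {pa pm pz} => [] [] /=; rewrite ?expr0 ?expr1 ?mulr1 ?mul1r ?mulrNN ?mulr1.
Qed.

Lemma ehom_id p (D : End) : End_par p D -> ehom p D = D.
Proof.
move=> pD; apply: linear_ext => z; rewrite ehomK (econj_par pD) !EndE.
by case: p {pD} => /=; rewrite ?expr0 ?expr1; lmod.
Qed.

Lemma ehom_neg p (D : End) : End_par p D -> ehom (~~ p) D = 0.
Proof.
move=> pD; apply: linear_ext => z; rewrite ehomK (econj_par pD) !EndE.
by case: p {pD} => /=; rewrite ?expr0 ?expr1; lmod.
Qed.

Lemma ehomE p q (D : End) : End_par p D -> ehom q D = if q == p then D else 0.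
Proof.
by case: p q => [] [] pD; rewrite ?(ehom_id pD) ?(ehom_neg pD).
Qed.

Lemma ehom_sum (D : End) : ehom false D + ehom true D = D.
Proof.
apply: linear_ext => z; rewrite !ehomK !EndE expr0 expr1; lmod.
Qed.

Definition resJ (D : End) (a : J) : J := (D (a, 0)).1.
Definition resM (D : End) (m : M) : M := (D (0, m)).2.

Lemma resJ_linl (c : K) (D E : End) a : resJ (c *: D + E) a = c *: resJ D a + resJ E a.
Proof. by []. Qed.
Lemma resM_linl (c : K) (D E : End) m : resM (c *: D + E) m = c *: resM D m + resM E m.
Proof. by []. Qed.
Fact resJ_linear (D : End) : linear (resJ D).
Proof.
move=> c a b; rewrite /resJ.
have -> : (c *: a + b, 0) = c *: (a, 0) + (b, 0) :> JM.
  by apply: pair_ext; rewrite /= ?scaler0 ?addr0.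
by rewrite (linD D) (linZ D).
Qed.
Fact resM_linear (D : End) : linear (resM D).
Proof.
move=> c m n; rewrite /resM.
have -> : (0, c *: m + n) = c *: (0, m) + (0, n) :> JM.
  by apply: pair_ext; rewrite /= ?scaler0 ?addr0.
by rewrite (linD D) (linZ D).
Qed.
HB.instance Definition _ D := GRing.isLinear.Build K J J *:%R (resJ D) (resJ_linear D).
HB.instance Definition _ D := GRing.isLinear.Build K M M *:%R (resM D) (resM_linear D).

(** The value of D on a (x) b: moving the odd part of D past a costs the sign of
    a, which is what par_sign 1 applies. *)
Definition act_tensJ (D : End) a b : Bs T :=
  classJ (resJ D a) b + classJ a (resJ (ehom false D) b)
  + classJ (par_sign 1 a) (resJ (ehom true D) b).
Definition act_tensM (D : End) m n : Bs T :=
  classM (resM D m) n + classM m (resM (ehom false D) n)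
  + classM (par_sign 1 m) (resM (ehom true D) n).

Fact act_tensJ_bilinear D : bilinear_for *:%R *:%R (act_tensJ D).
Proof.
apply: bilinearI => *; rewrite /act_tensJ
    !(resJ_linear _, par_sign_linear) ?classE; lmod.
Qed.
HB.instance Definition _ D := bilinear_isBilinear.Build K J J (Bs T)
  *:%R *:%R (act_tensJ D) (act_tensJ_bilinear D).

Fact act_tensM_bilinear D : bilinear_for *:%R *:%R (act_tensM D).
Proof.
apply: bilinearI => *; rewrite /act_tensM
    !(resM_linear _, par_sign_linear) ?classE; lmod.
Qed.
HB.instance Definition _ D := bilinear_isBilinear.Build K M M (Bs T)
  *:%R *:%R (act_tensM D) (act_tensM_bilinear D).

(** Stated as an existence result so that the map is known only through its
    values on pure tensors and is never unfolded. *)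
Fact act_exists (D : End) : {f : {linear JJMM T -> Bs T} |
  (forall a b, f (tensJ a b) = act_tensJ D a b) /\
  (forall m n, f (tensM m n) = act_tensM D m n)}.
Proof.
exists (JJMM_lift (act_tensJ D) (act_tensM D)).
by split=> [a b|m n]; [apply: JJMM_liftJ|apply: JJMM_liftM].
Qed.

Definition act (D : End) : {linear JJMM T -> Bs T} := sval (act_exists D).

Lemma act_tJ (D : End) a b : act D (tensJ a b) = act_tensJ D a b.
Proof. exact: (svalP (act_exists D)).1. Qed.
Lemma act_tM (D : End) m n : act D (tensM m n) = act_tensM D m n.
Proof. exact: (svalP (act_exists D)).2. Qed.

Lemma act_linear (c : K) (D E : End) x : act (c *: D + E) x = c *: act D x + act E x.
Proof.
apply: JJMM_lin_ext => [a b|m n].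
  rewrite !act_tJ /act_tensJ !ehom_linear !resJ_linl !classE; lmod.
rewrite !act_tM /act_tensM !ehom_linear !resM_linl !classE; lmod.
Qed.

Lemma act_homJ p i (D : End) a b : End_par p D -> par i a ->
  act D (tensJ a b) = classJ (resJ D a) b + (-1) ^+ (p * i) *: classJ a (resJ D b).
Proof.
move=> pD pa; rewrite act_tJ /act_tensJ !(ehomE _ pD) (par_signE _ pa) classE -addrA.
have e0 : resJ (0 : End) b = 0 by [].
by case: p pD => _ /=; rewrite e0 ?classE ?scaler0 ?add0r ?addr0 // mul0n scale1r.
Qed.

Lemma act_homM p i (D : End) m n : End_par p D -> par i m ->
  act D (tensM m n) = classM (resM D m) n + (-1) ^+ (p * i) *: classM m (resM D n).
Proof.
move=> pD pa; rewrite act_tM /act_tensM !(ehomE _ pD) (par_signE _ pa) classE -addrA.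
have e0 : resM (0 : End) n = 0 by [].
by case: p pD => _ /=; rewrite e0 ?classE ?scaler0 ?add0r ?addr0 // mul0n scale1r.
Qed.

Section ActDerivation.
Context (p : bool) (f : {linear J -> J}) (g : {linear M -> M}).
Context (fg : is_derivation p f g).
Local Notation D := (pair_map f g : End).

Lemma derivation_par : End_par p D.
Proof. by move=> q z [pa pm]; split; [apply: (derJ_par fg)|apply: (derM_par fg)]. Qed.

Lemma act_derJ i a b : par i a ->
  act D (tensJ a b) = classJ (f a) b + (-1) ^+ (p * i) *: classJ a (f b).
Proof. exact: (act_homJ _ derivation_par). Qed.

Lemma act_derM i m n : par i m ->
  act D (tensM m n) = classM (g m) n + (-1) ^+ (p * i) *: classM m (g n).
Proof. exact: (act_homM _ derivation_par). Qed.

(** A derivation sends a relation to the sum of the relations of the same family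
    in which it is applied to one argument at a time; the coefficients are the
    signs of moving D to that argument, adjusted by the signs with which the
    arguments already occur in the relation. *)
Lemma act_rel x : Rs_gen x -> act D x = 0.
Proof.
case=> {x} [i j a b pa pb|i j m n pm pn|i j k a b c pa pb pc|q i j a m n pa pm pn
           |i j k l m n r s pm pn pr ps]; rewrite !(linE (act D)).
- rewrite (act_derJ _ pa) (act_derJ _ pb).
  apply: (eq_of_lincomb (lincombD 1 (classJ_anti (derJ_par fg pa) pb)
    (lincombD ((-1) ^+ (p * i)) (classJ_anti pa (derJ_par fg pb)) (lincomb0 _)))).
  lmod.
- rewrite (act_derM _ pm) (act_derM _ pn).
  apply: (eq_of_lincomb (lincombD 1 (classM_sym (derM_par fg pm) pn)
    (lincombD ((-1) ^+ (p * i)) (classM_sym pm (derM_par fg pn)) (lincomb0 _)))).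
  lmod.
- rewrite (act_derJ _ (dot_par pa pb)) (act_derJ _ (dot_par pb pc)).
  rewrite (act_derJ _ (dot_par pc pa)) (der_dot fg pa pb) (der_dot fg pb pc).
  rewrite (der_dot fg pc pa) !classE.
  apply: (eq_of_lincomb
    (lincombD ((-1) ^+ (p * k)) (classJ_cycle (derJ_par fg pa) pb pc)
    (lincombD ((-1) ^+ (p * i)) (classJ_cycle pa (derJ_par fg pb) pc)
    (lincombD ((-1) ^+ (p * j)) (classJ_cycle pa pb (derJ_par fg pc))
    (lincomb0 _))))).
  lmod.
- rewrite (act_derM _ (bul_par pa pm)) (act_derM _ pm) (act_derJ _ (star_par pm pn)).
  rewrite (der_bul fg pa pm) (der_bul fg pa pn) (der_star fg pm pn) !classE.
  apply: (eq_of_lincomb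
    (lincombD 1 (classM_bul (derJ_par fg pa) pm pn)
    (lincombD ((-1) ^+ (p * q)) (classM_bul pa (derM_par fg pm) pn)
    (lincombD ((-1) ^+ (p * (q + i))) (classM_bul pa pm (derM_par fg pn))
    (lincomb0 _))))).
  lmod.
- rewrite (act_derM _ (partM_par pm pn pr)) (act_derM _ pr).
  rewrite (act_derM _ (partM_par pr ps pm)) (act_derM _ pm).
  (* With partM a variable, expanding the classes cannot unfold it. *)
  move: (der_partM fg pm pn pr) (der_partM fg pm pn ps) (der_partM fg pr ps pm)
    (der_partM fg pr ps pn) (classM_part (derM_par fg pm) pn pr ps)
    (classM_part pm (derM_par fg pn) pr ps) (classM_part pm pn (derM_par fg pr) ps)
    (classM_part pm pn pr (derM_par fg ps)).
  move: (@partM K T) => P -> -> -> -> R1 R2 R3 R4; rewrite !classE.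
  apply: (eq_of_lincomb (lincombD 1 R1 (lincombD ((-1) ^+ (p * i)) R2
    (lincombD ((-1) ^+ (p * (i + j))) R3
    (lincombD ((-1) ^+ (p * (i + j + k))) R4 (lincomb0 _)))))).
  lmod.
Qed.

End ActDerivation.
End Action.

(** * The morphism phi and its equivariance *)

Section Phi.
Context (K : numFieldType) (T : jternary K).
Local Notation J := (jtJ T).
Local Notation M := (jtM T).
Local Notation JM := (J * M)%type.
Local Notation End := {linear JM -> JM}.
Local Notation classJ := (@classJ K T).
Local Notation classM := (@classM K T).
Implicit Types (i j k l p q : bool) (a b c d : J) (m n r s t : M).

Fact ldot_bilinear i j : bilinear_for *:%R *:%R (ldot i j : J -> J -> End).
Proof.
apply: bilinearI => *; apply: linear_ext => z; rewrite EndD EndZ;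
  apply: pair_ext; rewrite !pairE /= /ldotJ /ldotM !(jtE T); lmod.
Qed.
HB.instance Definition _ i j := bilinear_isBilinear.Build K J J End
  *:%R *:%R (ldot i j) (ldot_bilinear i j).

Fact part_bilinear i j : bilinear_for *:%R *:%R (part i j : M -> M -> End).
Proof.
apply: bilinearI => *; apply: linear_ext => z; rewrite EndD EndZ;
  apply: pair_ext; rewrite !pairE /= /partJ /partM !(jtE T); lmod.
Qed.
HB.instance Definition _ i j := bilinear_isBilinear.Build K M M End
  *:%R *:%R (part i j) (part_bilinear i j).

Fact phi_tens_exists : {f : {linear JJMM T -> End} |
  (forall i j a b, par i a -> par j b -> f (tensJ a b) = ldot i j a b) /\
  (forall i j m n, par i m -> par j n -> f (tensM m n) = part i j m n)}.
Proof.
pose hJ i j : {bilinear J -> J -> End} := ldot i j.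
pose hM i j : {bilinear M -> M -> End} := part i j.
exists (JJMM_lift (hom_extension hJ) (hom_extension hM)); split=> i j u v pu pv.
  by apply: etrans (hom_extensionE hJ pu pv); apply: JJMM_liftJ.
by apply: etrans (hom_extensionE hM pu pv); apply: JJMM_liftM.
Qed.

Definition phi_tens : {linear JJMM T -> End} := sval phi_tens_exists.

Lemma phi_tensJ i j a b : par i a -> par j b -> phi_tens (tensJ a b) = ldot i j a b.
Proof. exact: (svalP phi_tens_exists).1. Qed.
Lemma phi_tensM i j m n : par i m -> par j n -> phi_tens (tensM m n) = part i j m n.
Proof. exact: (svalP phi_tens_exists).2. Qed.

Lemma ldot_fst i j a b z : (ldot i j a b z).1 = ldotJ i j a b z.1. Proof. by []. Qed.
Lemma ldot_snd i j a b z : (ldot i j a b z).2 = ldotM i j a b z.2. Proof. by []. Qed.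
Lemma part_fst i j m n z : (part i j m n z).1 = partJ i j m n z.1. Proof. by []. Qed.
Lemma part_snd i j m n z : (part i j m n z).2 = partM m n z.2. Proof. by []. Qed.
Definition genE := (ldot_fst, ldot_snd, part_fst, part_snd).

(** In the last family, the four terms are the commutators of \partial_(m, n)
    with \partial_(r, s) and of \partial_(r, s) with \partial_(m, n), expanded
    by the derivation property; they cancel. *)
Lemma phi_tens_rel x : Rs_gen x -> phi_tens x = 0.
Proof.
case=> {x} [i j a b pa pb|i j m n pm pn|i j k a b c pa pb pc|q i j a m n pa pm pn
           |i j k l m n r s pm pn pr ps]; rewrite !(linE phi_tens).
- rewrite (phi_tensJ pa pb) (phi_tensJ pb pa); apply: End_ext => q c m pc pm; rewrite !EndE.
  apply: pair_ext; rewrite !pairE !genE /=; first by rewrite (ldotJ_anti i j); lmod.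
  by rewrite (ldotM_anti i j); lmod.
- rewrite (phi_tensM pm pn) (phi_tensM pn pm); apply: End_ext => q c r pc pr; rewrite !EndE.
  apply: pair_ext; rewrite !pairE !genE /=; first by rewrite (partJ_sym pm pn pc); lmod.
  by rewrite (partM_sym pm pn pr); lmod.
- rewrite (phi_tensJ (dot_par pa pb) pc) (phi_tensJ (dot_par pb pc) pa).
  rewrite (phi_tensJ (dot_par pc pa) pb).
  apply: End_ext => q d m pd pm; rewrite !EndE.
  by apply: pair_ext; rewrite !pairE !genE /= ?(ldotJ_cycle pa pb pc pd) ?ldotM_cycle.
- rewrite (phi_tensM (bul_par pa pm) pn) (phi_tensM pm (bul_par pa pn)).
  rewrite (phi_tensJ (star_par pm pn) pa); apply: End_ext => k b r pb pr; rewrite !EndE.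
  apply: pair_ext; rewrite !pairE !genE /=; first by rewrite (partJ_bul pa pm pn pb); lmod.
  by rewrite (partM_bul_left pa pm pn pr); lmod.
- have pmn := part_derivation pm pn; have prs := part_derivation pr ps.
  rewrite (phi_tensM (partM_par pm pn pr) ps) (phi_tensM pr (partM_par pm pn ps)).
  rewrite (phi_tensM (partM_par pr ps pm) pn) (phi_tensM pm (partM_par pr ps pn)).
  apply: End_ext => q b t pb pt; rewrite !EndE.
  apply: pair_ext; rewrite !pairE !genE /=.
    have /= /eqP E1 := der_partJ pmn pr ps pb; rewrite -subr_eq0 in E1.
    have /= /eqP E2 := der_partJ prs pm pn pb; rewrite -subr_eq0 in E2.
    apply: (eq_of_lincomb (lincombD (-1) (eqP E1)
      (lincombD (- (-1) ^+ ((i + j) * (k + l))) (eqP E2) (lincomb0 _)))).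
    lmod.
  have /= /eqP E1 := der_partM pmn pr ps pt; rewrite -subr_eq0 in E1.
  have /= /eqP E2 := der_partM prs pm pn pt; rewrite -subr_eq0 in E2.
  apply: (eq_of_lincomb (lincombD (-1) (eqP E1)
    (lincombD (- (-1) ^+ ((i + j) * (k + l))) (eqP E2) (lincomb0 _)))).
  lmod.
Qed.

Definition phiE (x : Bs T) : End := phi_tens (repr x).

Lemma phiEE v : phiE (Bs_class v) = phi_tens v.
Proof. exact: (quot_repr (f := phi_tens) v phi_tens_rel). Qed.

Lemma Bs_classK (x : Bs T) : Bs_class (repr x) = x.
Proof. exact: quot_classK. Qed.

Fact phiE_linear : linear phiE.
Proof.
move=> c x y; rewrite -(Bs_classK x) -(Bs_classK y).
by rewrite -(linZ Bs_class) -(linD Bs_class) !phiEE (linD phi_tens) (linZ phi_tens).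
Qed.
HB.instance Definition _ := GRing.isLinear.Build K (Bs T) End *:%R phiE phiE_linear.

Lemma phiE0 : phiE 0 = 0.
Proof. exact: (lin0 phiE). Qed.
Lemma phiED x y : phiE (x + y) = phiE x + phiE y.
Proof. exact: (linD phiE). Qed.
Lemma phiEZ (c : K) x : phiE (c *: x) = c *: phiE x.
Proof. exact: (linZ phiE). Qed.

Lemma phiEJ i j a b : par i a -> par j b -> phiE (classJ a b) = ldot i j a b.
Proof. by move=> pa pb; rewrite phiEE (phi_tensJ pa pb). Qed.
Lemma phiEM i j m n : par i m -> par j n -> phiE (classM m n) = part i j m n.
Proof. by move=> pm pn; rewrite phiEE (phi_tensM pm pn). Qed.

Lemma phiE_span x : span (@innder_gen K T) (phiE x).
Proof.
elim/Bs_ind: x => [|c x y Sx Sy|i j a b pa pb|i j m n pm pn].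
- by rewrite phiE0; exact: span0.
- by rewrite phiED phiEZ; apply: spanP.
- by rewrite (phiEJ pa pb); apply/spanS; constructor.
- by rewrite (phiEM pm pn); apply/spanS; constructor.
Qed.

Lemma innder_gen_derivation (D : End) : innder_gen D ->
  exists p f g, is_derivation p f g /\ D = pair_map f g.
Proof.
case=> {D} [i j a b pa pb|i j m n pm pn].
  exists (i (+) j), (ldotJ i j a b), (ldotM i j a b).
  by split=> //; apply: ldot_derivation.
exists (i (+) j), (partJ i j m n), (partM m n).
by split=> //; apply: part_derivation.
Qed.

Definition Bs_act (D : End) (x : Bs T) : Bs T := act D (repr x).

Lemma Bs_actE (D : End) v : span (@innder_gen K T) D -> Bs_act D (Bs_class v) = act D v.
Proof.
move=> SD; apply: (quot_repr (f := act D)) => u Ru; move: D SD.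
apply: span_ind => [|c D E SD IH].
  by have := act_linear (-1) 0 0 u; rewrite !scaleN1r !addNr.
rewrite act_linear IH addr0.
by have [p [f [g [fg ->]]]] := innder_gen_derivation SD; rewrite (act_rel fg Ru) scaler0.
Qed.

Lemma supercommE p q (D E : End) z :
  supercomm p q D E z = D (E z) - (-1) ^+ (p * q) *: E (D z).
Proof. by []. Qed.

Lemma pair_map_fst (f : {linear J -> J}) (g : {linear M -> M}) (z : JM) :
  (pair_map f g z).1 = f z.1.
Proof. by []. Qed.
Lemma pair_map_snd (f : {linear J -> J}) (g : {linear M -> M}) (z : JM) :
  (pair_map f g z).2 = g z.2.
Proof. by []. Qed.

Section Equivariance.
Context (p : bool) (f : {linear J -> J}) (g : {linear M -> M}).
Context (fg : is_derivation p f g).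
Local Notation D := (pair_map f g : End).

Lemma phiE_actJ i j a b : par i a -> par j b ->
  phiE (act D (tensJ a b)) = supercomm p (i (+) j) D (ldot i j a b).
Proof.
move=> pa pb; rewrite (act_derJ fg _ pa) phiED phiEZ.
rewrite (phiEJ (derJ_par fg pa) pb) (phiEJ pa (derJ_par fg pb)).
apply: End_ext => q c m pc pm; rewrite supercommE !EndE.
apply: pair_ext; rewrite !pairE !(pair_map_fst, pair_map_snd, genE) /=.
  rewrite (der_ldotJ fg pa pb pc); lmod.
rewrite (der_ldotM fg pa pb pm); lmod.
Qed.

Lemma phiE_actM i j m n : par i m -> par j n ->
  phiE (act D (tensM m n)) = supercomm p (i (+) j) D (part i j m n).
Proof.
move=> pm pn; rewrite (act_derM fg _ pm) phiED phiEZ.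
rewrite (phiEM (derM_par fg pm) pn) (phiEM pm (derM_par fg pn)).
apply: End_ext => q c r pc pr; rewrite supercommE !EndE.
apply: pair_ext; rewrite !pairE !(pair_map_fst, pair_map_snd, genE) /=.
  rewrite (der_partJ fg pm pn pc); lmod.
rewrite (der_partM fg pm pn pr); lmod.
Qed.

End Equivariance.

(** For D and E homogeneous of parities p and q, the odd part of E is composed
    with g D g = (-1)^p D, so this is the supercommutator, but it is bilinear on
    all endomorphisms. *)
Definition sbracket (D E : End) : End :=
  (D \o E : End) - ((ehom false E \o D : End) + (ehom true E \o econj D : End)).

Lemma sbracket_hom p q (D E : End) : End_par p D -> End_par q E ->
  sbracket D E = supercomm p q D E.
Proof.
move=> pD qE; apply: linear_ext => z.
rewrite supercommE /sbracket !(ehomE _ qE) (econj_par pD) !EndE.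
case: q {qE} => /=; rewrite ?EndE ?muln0 ?muln1 ?add0r ?addr0.
  by rewrite (linZ E).
by rewrite expr0 scale1r.
Qed.

Lemma sbracket_linl (c : K) (D D' E : End) :
  sbracket (c *: D + D') E = c *: sbracket D E + sbracket D' E.
Proof.
rewrite /sbracket econj_linear.
move: (ehom false E) (ehom true E) (econj D) (econj D') => E0 E1 C C'.
by apply: linear_ext => z; rewrite !EndE !(linE E0) !(linE E1); lmod.
Qed.

Lemma sbracket_linr (c : K) (D E E' : End) :
  sbracket D (c *: E + E') = c *: sbracket D E + sbracket D E'.
Proof.
rewrite /sbracket !ehom_linear.
move: (ehom false E) (ehom true E) (ehom false E') (ehom true E') (econj D).
by move=> E0 E1 E0' E1' C; apply: linear_ext => z; rewrite !EndE !(linE D); lmod.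
Qed.

Lemma sbracket_gen (D E : End) : innder_gen D -> innder_gen E ->
  span (@innder_gen K T) (sbracket D E).
Proof.
move=> /innder_gen_derivation[p [f [g [fg ->]]]] [i j a b pa pb|i j m n pm pn].
  rewrite (sbracket_hom (derivation_par fg) (derivation_par (ldot_derivation pa pb))).
  by rewrite -(phiE_actJ fg pa pb); apply: phiE_span.
rewrite (sbracket_hom (derivation_par fg) (derivation_par (part_derivation pm pn))).
by rewrite -(phiE_actM fg pm pn); apply: phiE_span.
Qed.

Lemma sbracket0l E : sbracket 0 E = 0.
Proof. by have := sbracket_linl (-1) 0 0 E; rewrite !scaleN1r !addNr. Qed.
Lemma sbracket0r D : sbracket D 0 = 0.
Proof. by have := sbracket_linr (-1) D 0 0; rewrite !scaleN1r !addNr. Qed.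

Lemma sbracket_span (D E : End) : span (@innder_gen K T) D -> span (@innder_gen K T) E ->
  span (@innder_gen K T) (sbracket D E).
Proof.
move=> SD SE; move: D SD; apply: span_ind => [|c D D' GD IH].
  by rewrite sbracket0l; apply: span0.
rewrite sbracket_linl; apply: spanP IH; move: E SE; apply: span_ind => [|e E E' GE IH].
  by rewrite sbracket0r; apply: span0.
by rewrite sbracket_linr; apply: spanP IH; apply: sbracket_gen.
Qed.
End Phi.

(** * The bracket of B^s is super-anticommutative *)

Section Bracket.
Context (K : numFieldType) (T : jternary K).
Local Notation J := (jtJ T).
Local Notation M := (jtM T).
Local Notation JM := (J * M)%type.
Local Notation End := {linear JM -> JM}.
Local Notation classJ := (@classJ K T).
Local Notation classM := (@classM K T).
Implicit Types (i j k l p q : bool) (a b c d : J) (m n r s t : M).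

Lemma ldot_span i j a b : par i a -> par j b -> span (@innder_gen K T) (ldot i j a b).
Proof. by move=> pa pb; apply/spanS; constructor. Qed.
Lemma part_span i j m n : par i m -> par j n -> span (@innder_gen K T) (part i j m n).
Proof. by move=> pa pb; apply/spanS; constructor. Qed.

Lemma Bs_act_linl (c : K) (D E : End) x : Bs_act (c *: D + E) x = c *: Bs_act D x + Bs_act E x.
Proof. exact: act_linear. Qed.

Lemma Bs_act_linr (D : End) (c : K) x y : span (@innder_gen K T) D ->
  Bs_act D (c *: x + y) = c *: Bs_act D x + Bs_act D y.
Proof.
move=> SD; have E : c *: x + y = Bs_class (c *: repr x + repr y).
  by rewrite (linD Bs_class) (linZ Bs_class) !Bs_classK.
apply: etrans (congr1 (Bs_act D) E) _; apply: etrans (Bs_actE _ SD) _.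
by rewrite (linD (act D)) (linZ (act D)).
Qed.

Definition brB (x y : Bs T) : Bs T := Bs_act (phiE x) y.

Fact brB_bilinear : bilinear_for *:%R *:%R brB.
Proof.
apply: bilinearI => *; first by rewrite /brB phiED phiEZ Bs_act_linl.
by rewrite /brB Bs_act_linr //; apply: phiE_span.
Qed.
HB.instance Definition _ := bilinear_isBilinear.Build K (Bs T) (Bs T) (Bs T)
  *:%R *:%R brB brB_bilinear.
Definition brBE := bilinear_rules brB_bilinear.

Lemma brB_J i j a b v : par i a -> par j b ->
  brB (classJ a b) (Bs_class v) = act (ldot i j a b) v.
Proof. by move=> pa pb; rewrite /brB (phiEJ pa pb) Bs_actE //; apply: ldot_span. Qed.
Lemma brB_M i j m n v : par i m -> par j n ->
  brB (classM m n) (Bs_class v) = act (part i j m n) v.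
Proof. by move=> pm pn; rewrite /brB (phiEM pm pn) Bs_actE //; apply: part_span. Qed.

Lemma brB_JJ i j k a b c d : par i a -> par j b -> par k c ->
  brB (classJ a b) (classJ c d) = classJ (ldotJ i j a b c) d
    + (-1) ^+ ((i (+) j) * k) *: classJ c (ldotJ i j a b d).
Proof.
by move=> pa pb pc; rewrite (brB_J _ pa pb) (act_derJ (ldot_derivation pa pb) _ pc).
Qed.
Lemma brB_JM i j k a b m n : par i a -> par j b -> par k m ->
  brB (classJ a b) (classM m n) = classM (ldotM i j a b m) n
    + (-1) ^+ ((i (+) j) * k) *: classM m (ldotM i j a b n).
Proof.
by move=> pa pb pm; rewrite (brB_J _ pa pb) (act_derM (ldot_derivation pa pb) _ pm).
Qed.
Lemma brB_MJ i j k m n a b : par i m -> par j n -> par k a ->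
  brB (classM m n) (classJ a b) = classJ (partJ i j m n a) b
    + (-1) ^+ ((i (+) j) * k) *: classJ a (partJ i j m n b).
Proof.
by move=> pm pn pa; rewrite (brB_M _ pm pn) (act_derJ (part_derivation pm pn) _ pa).
Qed.
Lemma brB_MM i j k m n r s : par i m -> par j n -> par k r ->
  brB (classM m n) (classM r s) = classM (partM m n r) s
    + (-1) ^+ ((i (+) j) * k) *: classM r (partM m n s).
Proof.
by move=> pm pn pr; rewrite (brB_M _ pm pn) (act_derM (part_derivation pm pn) _ pr).
Qed.

(** Write [x, y] for the class of x (x) y and leave signs aside.  The cyclic
    relation for (a, bc, d) is [a(bc), d] + [(bc)d, a] + [da, bc] = 0.
    Together with the ones for (b, ac, d), (a, bd, c) and (b, ad, c), it
    accounts for all terms of the two brackets up to antisymmetry; the terms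
    [ad, bc] and [bd, ac], which are not in the brackets, occur twice and
    cancel by antisymmetry. *)
Lemma brB_antiJJ i j k l a b c d : par i a -> par j b -> par k c -> par l d ->
  brB (classJ a b) (classJ c d)
  + (-1) ^+ ((i (+) j) * (k (+) l)) *: brB (classJ c d) (classJ a b) = 0.
Proof.
move=> pa pb pc pd; rewrite (brB_JJ _ pa pb pc) (brB_JJ _ pc pd pa) /ldotJ !classE.
rewrite (dotC pd pa) (dotC pd pb) (dotC pc pa) (dotC pc pb) !(bilE_for (dot T), classE).
have pac := dot_par pa pc; have pbc := dot_par pb pc.
have pad := dot_par pa pd; have pbd := dot_par pb pd.
have C1 := classJ_cycle pa pbc pd; have C2 := classJ_cycle pb pac pd.
have C3 := classJ_cycle pa pbd pc; have C4 := classJ_cycle pb pad pc.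
rewrite (dotC pbc pd) (dotC pd pa) !(bilE_for (dot T), classE) in C1.
rewrite (dotC pac pd) (dotC pd pb) !(bilE_for (dot T), classE) in C2.
rewrite (dotC pbd pc) (dotC pc pa) !(bilE_for (dot T), classE) in C3.
rewrite (dotC pad pc) (dotC pc pb) !(bilE_for (dot T), classE) in C4.
have A1 := classJ_anti pc (dot_par pa pbd).
have A2 := classJ_anti pc (dot_par pb pad).
have A3 := classJ_anti pa (dot_par pc pbd).
have A4 := classJ_anti pa (dot_par pd pbc).
have A5 := classJ_anti pad pbc.
have A6 := classJ_anti pbd pac.
apply: (eq_of_lincomb
  (lincombD ((-1) ^+ (i * l)) C1
  (lincombD (- (-1) ^+ (i * j + j * l)) C2
  (lincombD (- (-1) ^+ (k * l + i * k)) C3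
  (lincombD ((-1) ^+ (i * j + k * l + j * k)) C4
  (lincombD ((-1) ^+ (i * k + j * k)) A1
  (lincombD (- (-1) ^+ (i * k + j * k + i * j)) A2
  (lincombD ((-1) ^+ (j * k)) A3
  (lincombD (- (-1) ^+ (j * l + k * l)) A4
  (lincombD (- (-1) ^+ (j * l + k * l)) A5
  (lincombD ((-1) ^+ (i * j + i * l + k * l)) A6 (lincomb0 _)))))))))))).
lmod.
Qed.

(** The relations linking J and M, for (a, bm, n), (b, am, n), (a, m, bn) and
    (b, m, an), move both operators from m to n; the mixed terms in am and bn
    cancel, and what is left is the value of \partial_(m, n) on a and b. *)
Lemma brB_antiJM i j k l a b m n : par i a -> par j b -> par k m -> par l n ->
  brB (classJ a b) (classM m n)
  + (-1) ^+ ((i (+) j) * (k (+) l)) *: brB (classM m n) (classJ a b) = 0.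
Proof.
move=> pa pb pm pn; rewrite (brB_JM _ pa pb pm) (brB_MJ _ pm pn pa).
rewrite (partJE _ _ _ _ pa) (partJE _ _ _ _ pb) /ldotM !classE.
have B1 := classM_bul pa (bul_par pb pm) pn.
have B2 := classM_bul pb (bul_par pa pm) pn.
have B3 := classM_bul pa pm (bul_par pb pn).
have B4 := classM_bul pb pm (bul_par pa pn).
have A1 := classJ_anti pa (star_par (bul_par pb pm) pn).
have A2 := classJ_anti pa (star_par pm (bul_par pb pn)).
apply: (eq_of_lincomb
  (lincombD 4^-1 B1 (lincombD (- (4^-1 * (-1) ^+ (i * j))) B2
  (lincombD (- (4^-1 * (-1) ^+ (j * k))) B3
  (lincombD (4^-1 * (-1) ^+ (i * j + i * k)) B4
  (lincombD 2^-1 A1 (lincombD (- (2^-1 * (-1) ^+ (j * k))) A2 (lincomb0 _)))))))).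
lmod.
Qed.

Lemma brB_antiMM i j k l m n r s : par i m -> par j n -> par k r -> par l s ->
  brB (classM m n) (classM r s)
  + (-1) ^+ ((i (+) j) * (k (+) l)) *: brB (classM r s) (classM m n) = 0.
Proof.
move=> pm pn pr ps; rewrite (brB_MM _ pm pn pr) (brB_MM _ pr ps pm).
have R := classM_part pm pn pr ps.
apply: (eq_of_lincomb (lincombD 1 R (lincomb0 _))).
move: (@partM K T) => P; lmod.
Qed.

Lemma Bs_par_hom p (P : Bs T -> Prop) :
    P 0 -> (forall (c : K) x y, P x -> P y -> P (c *: x + y)) ->
    (forall i j a b, par i a -> par j b -> i (+) j = p -> P (classJ a b)) ->
    (forall i j m n, par i m -> par j n -> i (+) j = p -> P (classM m n)) ->
  forall x, Bs_par T p x -> P x.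
Proof.
move=> P0 PP PJ PM; apply: span_ind => // c x y Hx Py; apply: PP => //.
by case: Hx => [i j a b pa pb e|i j m n pm pn e]; [apply: PJ pa pb e|apply: PM pm pn e].
Qed.

Lemma brB_anti p q x y : Bs_par T p x -> Bs_par T q y ->
  brB x y + (-1) ^+ (p * q) *: brB y x = 0.
Proof.
move: x => z px; move: z px.
apply: Bs_par_hom => [|c x x' IHx IHx' qy|i j a b pa pb <-|i j m n pm pn <-].
- by rewrite !brBE scaler0 addr0.
- rewrite !brBE.
  apply: (eq_of_lincomb (lincombD c (IHx qy) (lincombD 1 (IHx' qy) (lincomb0 _)))).
  lmod.
- move: y; apply: Bs_par_hom => [|c x x' IHx IHx'|k l c d pc pd <-|k l m n pm pn <-].
  + by rewrite !brBE scaler0 addr0.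
  + rewrite !brBE; apply: (eq_of_lincomb (lincombD c IHx (lincombD 1 IHx' (lincomb0 _)))).
    lmod.
  + exact: (brB_antiJJ pa pb pc pd).
  + exact: (brB_antiJM pa pb pm pn).
- move: y; apply: Bs_par_hom => [|c x x' IHx IHx'|k l a b pa pb <-|k l r s pr ps <-].
  + by rewrite !brBE scaler0 addr0.
  + rewrite !brBE; apply: (eq_of_lincomb (lincombD c IHx (lincombD 1 IHx' (lincomb0 _)))).
    lmod.
  + have H := brB_antiJM pa pb pm pn.
    apply: (eq_of_lincomb (lincombD ((-1) ^+ ((k (+) l) * (i (+) j))) H (lincomb0 _))).
    lmod.
  + exact: (brB_antiMM pm pn pr ps).
Qed.
End Bracket.

(** * B^s and InnDer as Lie superalgebras *)

Section LieStructure.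
Context (K : numFieldType) (T : jternary K).
Local Notation J := (jtJ T).
Local Notation M := (jtM T).
Local Notation JM := (J * M)%type.
Local Notation End := {linear JM -> JM}.
Local Notation classJ := (@classJ K T).
Local Notation classM := (@classM K T).
Implicit Types (i j k l p q : bool) (a b c d : J) (m n r s t : M).

Lemma supercomm_par p q (D E : End) : End_par p D -> End_par q E ->
  End_par (p (+) q) (supercomm p q D E).
Proof.
move=> pD qE k z kz; rewrite supercommE; apply: JM_parD.
  by rewrite -addbA; apply/pD/qE.
rewrite -scaleNr; apply: JM_parZ; rewrite (addbC p) -addbA; exact/qE/pD.
Qed.

Section ActOnClasses.
Context (D : End) (SD : span (@innder_gen K T) D).

Lemma Bs_act0 : Bs_act D 0 = 0.
Proof. by have := Bs_act_linr (-1) 0 0 SD; rewrite !scaleN1r !addNr. Qed.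
Lemma Bs_actD x y : Bs_act D (x + y) = Bs_act D x + Bs_act D y.
Proof. by have := Bs_act_linr 1 x y SD; rewrite !scale1r. Qed.
Lemma Bs_actZ (c : K) x : Bs_act D (c *: x) = c *: Bs_act D x.
Proof.
apply: etrans (congr1 (Bs_act D) (esym (addr0 (c *: x)))) _.
apply: etrans (Bs_act_linr c x 0 SD) _.
exact: etrans (congr1 (+%R (c *: Bs_act D x)) Bs_act0) (addr0 _).
Qed.
Lemma Bs_actJ a b : Bs_act D (classJ a b) = act D (tensJ a b).
Proof. exact: Bs_actE. Qed.
Lemma Bs_actM m n : Bs_act D (classM m n) = act D (tensM m n).
Proof. exact: Bs_actE. Qed.
End ActOnClasses.

Lemma Bs_act_linear (D : End) : span (@innder_gen K T) D -> linear (Bs_act D).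
Proof. by move=> SD c x y; apply: Bs_act_linr. Qed.

Lemma Bs_act_supercomm p q f g f' g' x : is_derivation p f g -> is_derivation q f' g' ->
  let D := pair_map f g : End in let E := pair_map f' g' : End in
  span (@innder_gen K T) D -> span (@innder_gen K T) E ->
  Bs_act (supercomm p q D E) x
  = Bs_act D (Bs_act E x) - (-1) ^+ (p * q) *: Bs_act E (Bs_act D x).
Proof.
move=> fg fg' D E SD SE; have pD := derivation_par fg; have qE := derivation_par fg'.
have SDE : span (@innder_gen K T) (supercomm p q D E).
  by rewrite -(sbracket_hom pD qE); apply: sbracket_span.
elim/Bs_ind: x => [|c x y IHx IHy|i j a b pa pb|i j m n pm pn].
- by rewrite (Bs_act0 SDE) (Bs_act0 SD) (Bs_act0 SE) (Bs_act0 SD) scaler0 subr0.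
- rewrite (Bs_act_linr c x y SDE) (Bs_act_linr c x y SD) (Bs_act_linr c x y SE).
  rewrite (Bs_act_linr c _ _ SD) (Bs_act_linr c _ _ SE) IHx IHy.
  lmod.
- rewrite (Bs_actJ SDE) (Bs_actJ SE) (Bs_actJ SD) (act_derJ fg' _ pa) (act_derJ fg _ pa).
  rewrite (Bs_actD SD) (Bs_actD SE) (Bs_actZ SD) (Bs_actZ SE) !(Bs_actJ SD) !(Bs_actJ SE).
  rewrite (act_derJ fg _ (derJ_par fg' pa)) (act_derJ fg' _ (derJ_par fg pa)).
  rewrite (act_derJ fg _ pa) (act_derJ fg' _ pa).
  rewrite (act_homJ _ (supercomm_par pD qE) pa).
  have resJ_sc c : resJ (supercomm p q D E) c = f (f' c) - (-1) ^+ (p * q) *: f' (f c).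
    by [].
  rewrite !resJ_sc !classE; lmod.
- rewrite (Bs_actM SDE) (Bs_actM SE) (Bs_actM SD) (act_derM fg' _ pm) (act_derM fg _ pm).
  rewrite (Bs_actD SD) (Bs_actD SE) (Bs_actZ SD) (Bs_actZ SE) !(Bs_actM SD) !(Bs_actM SE).
  rewrite (act_derM fg _ (derM_par fg' pm)) (act_derM fg' _ (derM_par fg pm)).
  rewrite (act_derM fg _ pm) (act_derM fg' _ pm).
  rewrite (act_homM _ (supercomm_par pD qE) pm).
  have resM_sc r : resM (supercomm p q D E) r = g (g' r) - (-1) ^+ (p * q) *: g' (g r).
    by [].
  rewrite !resM_sc !classE; lmod.
Qed.

Lemma phiE_par p x : Bs_par T p x -> End_par p (phiE x).
Proof.
elim/Bs_par_hom=> {x} [|c x y Px Py|i j a b pa pb <-|i j m n pm pn <-].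
- rewrite phiE0 => q z _; split; exact: (par0 (par_superspace _)).
- rewrite phiED phiEZ => q z qz; rewrite EndD EndZ.
  by apply: JM_parD; [apply/JM_parZ/Px|apply: Py].
- by rewrite (phiEJ pa pb); apply/derivation_par/ldot_derivation.
- by rewrite (phiEM pm pn); apply/derivation_par/part_derivation.
Qed.

Lemma sbracket_linear_l (E : End) : linear (fun D => sbracket D E).
Proof. by move=> c D D'; apply: sbracket_linl. Qed.
Lemma sbracket_linear_r (D : End) : linear (sbracket D).
Proof. by move=> c E E'; apply: sbracket_linr. Qed.

(** This is the identity [D, <a, b>] = <D a, b> + <a, D b> and its analogue for
    \partial_(m, n), read on classes. *)
Lemma phiE_Bs_act p f g x : is_derivation p f g ->
  let D := pair_map f g : End in span (@innder_gen K T) D ->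
  phiE (Bs_act D x) = sbracket D (phiE x).
Proof.
move=> fg D SD; have pD := derivation_par fg; have lD := Bs_act_linear SD.
move: x; apply: Bs_linear_ext => [||i j a b pa pb|i j m n pm pn].
- exact: linear_compose (@phiE_linear K T) lD.
- exact: linear_compose (sbracket_linear_r D) (@phiE_linear K T).
- rewrite (Bs_actJ SD) (phiE_actJ fg pa pb) (phiEJ pa pb).
  by rewrite (sbracket_hom pD (derivation_par (ldot_derivation pa pb))).
- rewrite (Bs_actM SD) (phiE_actM fg pm pn) (phiEM pm pn).
  by rewrite (sbracket_hom pD (derivation_par (part_derivation pm pn))).
Qed.

Lemma brB_linear_l (y : Bs T) : linear (fun x => brB x y).
Proof. by move=> c x x'; rewrite /brB phiE_linear Bs_act_linl. Qed.
Lemma brB_linear_r (x : Bs T) : linear (brB x).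
Proof. exact: Bs_act_linear (phiE_span x). Qed.

Lemma phiE_brB (x y : Bs T) : phiE (brB x y) = sbracket (phiE x) (phiE y).
Proof.
move: x; apply: Bs_linear_ext => [||i j a b pa pb|i j m n pm pn].
- exact: linear_compose (@phiE_linear K T) (brB_linear_l y).
- exact: linear_compose (sbracket_linear_l (phiE y)) (@phiE_linear K T).
- rewrite /brB (phiEJ pa pb).
  by apply: (phiE_Bs_act _ (ldot_derivation pa pb)); apply: ldot_span.
- rewrite /brB (phiEM pm pn).
  by apply: (phiE_Bs_act _ (part_derivation pm pn)); apply: part_span.
Qed.

Lemma Bs_homog_derivation p x : @Bs_homog K T p x -> exists f g,
  [/\ is_derivation p f g, phiE x = pair_map f g & span (@innder_gen K T) (phiE x)].
Proof.
case=> [i j a b pa pb <-|i j m n pm pn <-].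
  exists (ldotJ i j a b), (ldotM i j a b).
  by split; [apply: ldot_derivation|rewrite (phiEJ pa pb)|apply: phiE_span].
exists (partJ i j m n), (partM m n).
by split; [apply: part_derivation|rewrite (phiEM pm pn)|apply: phiE_span].
Qed.

(** With D = phi(x) and E = phi(y), this is [D, E] . z = D . (E . z) - E . (D . z)
    up to sign, since phi of [x, y] is [D, E]. *)
Lemma brB_jacobi i j k x y z : Bs_par T i x -> Bs_par T j y -> Bs_par T k z ->
  brB x (brB y z) = brB (brB x y) z + (-1) ^+ (i * j) *: brB y (brB x z).
Proof.
move=> ix jy _; move: x ix; apply: span_linear_ext.
- exact: brB_linear_l.
- apply: linear_addf.
    exact: linear_compose (brB_linear_l z) (brB_linear_l y).
  apply: linear_scalef; exact: linear_compose (brB_linear_r y) (brB_linear_l z).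
move=> x hx; move: y jy; apply: span_linear_ext.
- exact: linear_compose (brB_linear_r x) (brB_linear_l z).
- apply: linear_addf.
    exact: linear_compose (brB_linear_l z) (brB_linear_r x).
  by apply: linear_scalef; apply: brB_linear_l.
move=> y hy.
have [f [g [fg Dx Sx]]] := Bs_homog_derivation hx.
have [f' [g' [fg' Dy Sy]]] := Bs_homog_derivation hy.
have -> : brB (brB x y) z = Bs_act (sbracket (phiE x) (phiE y)) z.
  by rewrite -phiE_brB.
rewrite Dx Dy (sbracket_hom (derivation_par fg) (derivation_par fg')).
rewrite Dx in Sx; rewrite Dy in Sy.
by rewrite (Bs_act_supercomm _ fg fg' Sx Sy) /brB Dx Dy subrK.
Qed.
Lemma eq_opp_eq0 (V : lmodType K) (x : V) : x = - x -> x = 0.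
Proof.
move=> e; have /eqP : 2%:R *: x = 0 by rewrite scaler_nat mulr2n {2}e subrr.
by rewrite scaler_eq0 pnatr_eq0 => /eqP.
Qed.

Lemma Bs_act_par p q f g y : is_derivation p f g ->
  let D := pair_map f g : End in span (@innder_gen K T) D ->
  Bs_par T q y -> Bs_par T (p (+) q) (Bs_act D y).
Proof.
move=> fg D SD; move: y.
apply: Bs_par_hom => [|c x y Px Py|i j a b pa pb <-|i j m n pm pn <-].
- rewrite (Bs_act0 SD); exact: span0.
- rewrite (Bs_act_linr c x y SD); exact: spanP.
- rewrite (Bs_actJ SD) (act_derJ fg _ pa) addrC; apply: spanP; apply/spanS.
    by apply: (Bs_homogJ pa (derJ_par fg pb)); rewrite addbCA.
  by apply: (Bs_homogJ (derJ_par fg pa) pb); rewrite addbA.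
- rewrite (Bs_actM SD) (act_derM fg _ pm) addrC; apply: spanP; apply/spanS.
    by apply: (Bs_homogM pm (derM_par fg pn)); rewrite addbCA.
  by apply: (Bs_homogM (derM_par fg pm) pn); rewrite addbA.
Qed.

Lemma brB_par p q x y : Bs_par T p x -> Bs_par T q y -> Bs_par T (p (+) q) (brB x y).
Proof.
move=> px qy; move: x px; apply: span_ind => [|c x x' hx IH].
  have -> : brB 0 y = 0 := linear_at0 (brB_linear_l y); exact: span0.
have -> : brB (c *: x + x') y = c *: brB x y + brB x' y := brB_linear_l y c x x'.
apply: spanP IH; have [f [g [fg Dx Sx]]] := Bs_homog_derivation hx.
by rewrite /brB Dx; apply: (Bs_act_par fg) qy; rewrite -Dx.
Qed.

Definition scaleJ (e : K) a b : Bs T := e *: classJ a b.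
Definition scaleM (e : K) m n : Bs T := e *: classM m n.
Fact scaleJ_bilinear e : bilinear_for *:%R *:%R (scaleJ e).
Proof. apply: bilinearI => *; rewrite /scaleJ !classE; lmod. Qed.
Fact scaleM_bilinear e : bilinear_for *:%R *:%R (scaleM e).
Proof. apply: bilinearI => *; rewrite /scaleM !classE; lmod. Qed.
HB.instance Definition _ e := bilinear_isBilinear.Build K J J (Bs T)
  *:%R *:%R (scaleJ e) (scaleJ_bilinear e).
HB.instance Definition _ e := bilinear_isBilinear.Build K M M (Bs T)
  *:%R *:%R (scaleM e) (scaleM_bilinear e).

(** The grading involution of J (x) J (+) M (x) M, with values in B^s. *)
Fact flip_tens_exists : {f : {linear JJMM T -> Bs T} |
  (forall i j a b, par i a -> par j b ->
     f (tensJ a b) = sgn K true (i (+) j) *: classJ a b) /\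
  (forall i j m n, par i m -> par j n ->
     f (tensM m n) = sgn K true (i (+) j) *: classM m n)}.
Proof.
pose hJ i j : {bilinear J -> J -> Bs T} := scaleJ (sgn K true (i (+) j)).
pose hM i j : {bilinear M -> M -> Bs T} := scaleM (sgn K true (i (+) j)).
exists (JJMM_lift (hom_extension hJ) (hom_extension hM)); split=> i j u v pu pv.
  by apply: etrans (hom_extensionE hJ pu pv); apply: JJMM_liftJ.
by apply: etrans (hom_extensionE hM pu pv); apply: JJMM_liftM.
Qed.

Definition flip_tens : {linear JJMM T -> Bs T} := sval flip_tens_exists.
Lemma flip_tensJ i j a b : par i a -> par j b ->
  flip_tens (tensJ a b) = sgn K true (i (+) j) *: classJ a b.
Proof. exact: (svalP flip_tens_exists).1. Qed.
Lemma flip_tensM i j m n : par i m -> par j n ->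
  flip_tens (tensM m n) = sgn K true (i (+) j) *: classM m n.
Proof. exact: (svalP flip_tens_exists).2. Qed.

Lemma flip_tens_rel x : Rs_gen x -> flip_tens x = 0.
Proof.
case=> {x} [i j a b pa pb|i j m n pm pn|i j k a b c pa pb pc|q i j a m n pa pm pn
           |i j k l m n r s pm pn pr ps]; rewrite !(linE flip_tens).
- rewrite (flip_tensJ pa pb) (flip_tensJ pb pa).
  apply: (eq_of_lincomb (lincombD (sgn K true (i (+) j)) (classJ_anti pa pb)
    (lincomb0 _))).
  lmod.
- rewrite (flip_tensM pm pn) (flip_tensM pn pm).
  apply: (eq_of_lincomb (lincombD (sgn K true (i (+) j)) (classM_sym pm pn)
    (lincomb0 _))).
  lmod.
- rewrite (flip_tensJ (dot_par pa pb) pc) (flip_tensJ (dot_par pb pc) pa).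
  rewrite (flip_tensJ (dot_par pc pa) pb).
  apply: (eq_of_lincomb (lincombD (sgn K true (i (+) j (+) k))
    (classJ_cycle pa pb pc) (lincomb0 _))).
  lmod.
- rewrite (flip_tensM (bul_par pa pm) pn) (flip_tensM pm (bul_par pa pn)).
  rewrite (flip_tensJ (star_par pm pn) pa).
  apply: (eq_of_lincomb (lincombD (sgn K true (q (+) i (+) j))
    (classM_bul pa pm pn) (lincomb0 _))).
  lmod.
- rewrite (flip_tensM (partM_par pm pn pr) ps) (flip_tensM pr (partM_par pm pn ps)).
  rewrite (flip_tensM (partM_par pr ps pm) pn) (flip_tensM pm (partM_par pr ps pn)).
  apply: (eq_of_lincomb (lincombD (sgn K true (i (+) j (+) k (+) l))
    (classM_part pm pn pr ps) (lincomb0 _))).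
  move: (@partM K T) => P; lmod.
Qed.

Definition flip (x : Bs T) : Bs T := flip_tens (repr x).

Lemma flipE v : flip (Bs_class v) = flip_tens v.
Proof. exact: (quot_repr (f := flip_tens) v flip_tens_rel). Qed.

Fact flip_linear : linear flip.
Proof.
move=> c x y; have E : c *: x + y = Bs_class (c *: repr x + repr y).
  by rewrite (linD Bs_class) (linZ Bs_class) !Bs_classK.
apply: etrans (congr1 flip E) _; apply: etrans (flipE _) _.
by rewrite (linD flip_tens) (linZ flip_tens).
Qed.

(** Hence an element that is both even and odd is its own opposite. *)
Lemma flip_par p x : Bs_par T p x -> flip x = sgn K true p *: x.
Proof.
move: x; apply: span_linear_ext => [||x].
- exact: flip_linear.
- by apply: linear_scalef => c x y.
- case=> [i j a b pa pb <-|i j m n pm pn <-].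
    exact: etrans (flipE _) (flip_tensJ pa pb).
  exact: etrans (flipE _) (flip_tensM pm pn).
Qed.

Lemma Bs_superspace : is_superspace (Bs_par T).
Proof.
split=> [i|i c u v|x|x evenx oddx].
- exact: span0.
- exact: spanP.
- move: x; have hom p y : Bs_par T p y ->
      exists u w, [/\ Bs_par T false u, Bs_par T true w & y = u + w].
    case: p => py; first by exists 0, y; rewrite add0r; split=> //; apply: span0.
    by exists y, 0; rewrite addr0; split=> //; apply: span0.
  apply: Bs_ind => [|c x y [u [w [pu pw ->]]] [u' [w' [pu' pw' ->]]]
                   |i j a b pa pb|i j m n pm pn].
  + by apply: (hom false); apply: span0.
  + exists (c *: u + u'), (c *: w + w'); split; try exact: spanP.
    by rewrite scalerDr addrACA.
  + by apply: (hom (i (+) j)); apply/spanS; apply: Bs_homogJ pa pb _.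
  + by apply: (hom (i (+) j)); apply/spanS; apply: Bs_homogM pm pn _.
- have := etrans (esym (flip_par evenx)) (flip_par oddx).
  rewrite /sgn muln0 muln1 expr0 expr1 scale1r scaleN1r => e0.
  exact: eq_opp_eq0 e0.
Qed.

Lemma innder_valP (D : InnDer T) : span (@innder_gen K T) (innder_val D).
Proof. by case: D => D /= /asboolP. Qed.

Definition mkInnDer (D : End) (SD : span (@innder_gen K T) D) : InnDer T :=
  @MkInnDer K T D (asboolT SD).

Fact innder_val_linear : linear (@innder_val K T).
Proof. exact: (linearP (val : InnDer T -> End)). Qed.

Lemma innder_valZ (c : K) D : innder_val (c *: D) = c *: innder_val D :> End.
Proof. exact: linear_scale innder_val_linear c D. Qed.
Lemma innder_valD (D E : InnDer T) :
  innder_val (D + E) = innder_val D + innder_val E :> End.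
Proof. exact: linear_add innder_val_linear D E. Qed.

Definition brI (D E : InnDer T) : InnDer T :=
  mkInnDer (sbracket_span (innder_valP D) (innder_valP E)).

Fact brI_bilinear : bilinear_for *:%R *:%R brI.
Proof.
apply: bilinearI => c D D' E; apply: val_inj;
  apply: etrans _ (esym (innder_val_linear _ _ _)).
- apply: etrans (congr1 (fun F => sbracket F (innder_val E)) (innder_val_linear c D D')) _.
  exact: sbracket_linl.
- apply: etrans (congr1 (sbracket (innder_val D)) (innder_val_linear c D' E)) _.
  exact: sbracket_linr.
Qed.
HB.instance Definition _ := bilinear_isBilinear.Build K (InnDer T) (InnDer T) (InnDer T)
  *:%R *:%R brI brI_bilinear.

Definition phi (x : Bs T) : InnDer T := mkInnDer (phiE_span x).

Fact phi_linear : linear phi.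
Proof.
move=> c x y; apply: val_inj; apply: etrans _ (esym (innder_val_linear _ _ _)).
exact: phiE_linear.
Qed.
HB.instance Definition _ := GRing.isLinear.Build K (Bs T) (InnDer T) *:%R phi phi_linear.

Lemma End_parP p (D E : End) (c : K) : End_par p D -> End_par p E -> End_par p (c *: D + E).
Proof.
by move=> pD pE q z qz; rewrite EndD EndZ; apply: JM_parD; [apply/JM_parZ/pD|apply: pE].
Qed.

Lemma End_par0 p : End_par p (0 : End).
Proof. by move=> q z _; split; apply: (par0 (par_superspace _)). Qed.

(** InnDer is spanned by homogeneous endomorphisms, so it contains the
    homogeneous parts of its elements. *)
Lemma ehom_span p (D : End) : span (@innder_gen K T) D ->
  span (@innder_gen K T) (ehom p D) /\ End_par p (ehom p D).
Proof.
move: D; apply: span_ind => [|c D E GD [SE pE]].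
  have -> : ehom p (0 : End) = 0 := linear_at0 (ehom_linear p).
  by split; [apply: span0|apply: End_par0].
have -> : ehom p (c *: D + E) = c *: ehom p D + ehom p E := ehom_linear p c D E.
have [q [f [g [fg eD]]]] := innder_gen_derivation GD.
have pD : End_par q D by rewrite eD; apply: derivation_par.
split; [apply: spanP SE|apply: End_parP pE]; rewrite (ehomE _ pD);
  case: eqP => [e|_]; rewrite ?e //.
- exact: spanS.
- exact: span0.
- exact: End_par0.
Qed.

Lemma InnDer_superspace : is_superspace (InnDer_par T).
Proof.
split=> [i|i c D E pD pE|D|D evenD oddD].
- exact: End_par0.
- by move: (End_parP c pD pE); rewrite -innder_val_linear.
- have [S0 p0] := ehom_span false (innder_valP D).
  have [S1 p1] := ehom_span true (innder_valP D).
  exists (mkInnDer S0), (mkInnDer S1); split=> //.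
  apply: val_inj; rewrite -[mkInnDer S0]scale1r; apply: etrans _ (esym (innder_val_linear _ _ _)).
  by rewrite /= scale1r ehom_sum.
- apply: val_inj; apply: End_ext => q a m pa pm; have qz : JM_par q (a, m) by [].
  have [p0a p0m] := evenD q _ qz; have [p1a p1m] := oddD q _ qz.
  apply: pair_ext; apply: (@par_cap_any _ _ q); rewrite //=.
Qed.

Fact supercomm_anti p q (D E : End) :
  supercomm p q D E = - (-1) ^+ (p * q) *: supercomm q p E D.
Proof. apply: linear_ext => z; rewrite EndZ !supercommE; lmod. Qed.

Fact supercomm_jacobi i j k (D E F : End) :
  supercomm i (j (+) k) D (supercomm j k E F)
  = supercomm (i (+) j) k (supercomm i j D E) F
    + (-1) ^+ (i * j) *: supercomm j (i (+) k) E (supercomm i k D F).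
Proof.
apply: linear_ext => z; rewrite EndD EndZ !supercommE.
rewrite (linD D) (linN D) (linZ D) (linD E) (linN E) (linZ E) (linD F) (linN F) (linZ F).
lmod.
Qed.

Lemma InnDer_lie : is_lie_superalgebra (InnDer_par T) brI.
Proof.
split=> [|p q D E pD qE|p q D E pD qE|i j k D E F iD jE kF].
- exact: InnDer_superspace.
- by rewrite /InnDer_par /= (sbracket_hom pD qE); apply: supercomm_par.
- apply: val_inj; apply: etrans _ (esym (innder_valZ _ _)).
  apply: etrans (sbracket_hom pD qE) _; rewrite supercomm_anti.
  by congr (_ *: _); apply: esym; apply: sbracket_hom.
- apply: val_inj; apply: etrans _ (esym (innder_valD _ _)).
  have sDE := sbracket_hom iD jE; have sEF := sbracket_hom jE kF; have sDF := sbracket_hom iD kF.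
  have DE_par : End_par (i (+) j) (sbracket (innder_val D) (innder_val E)).
    by rewrite sDE; apply: supercomm_par.
  have EF_par : End_par (j (+) k) (sbracket (innder_val E) (innder_val F)).
    by rewrite sEF; apply: supercomm_par.
  have DF_par : End_par (i (+) k) (sbracket (innder_val D) (innder_val F)).
    by rewrite sDF; apply: supercomm_par.
  apply: etrans (sbracket_hom iD EF_par) _; rewrite sEF supercomm_jacobi.
  congr (_ + _).
    by apply: etrans _ (esym (sbracket_hom DE_par kF)); rewrite sDE.
  apply: etrans _ (esym (innder_valZ _ _)); congr (_ *: _).
  by apply: etrans _ (esym (sbracket_hom jE DF_par)); rewrite sDF.
Qed.

End LieStructure.

(** * The central extension *)

Theorem central_extension (K : numFieldType) (T : jternary K) :
  exists (brB : {bilinear Bs T -> Bs T -> Bs T})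
         (brI : {bilinear InnDer T -> InnDer T -> InnDer T})
         (phi : {linear Bs T -> InnDer T}),
  [/\ is_lie_superalgebra (Bs_par T) brB,
      [/\ forall (i j k l : bool) (a b c d : jtJ T),
             par i a -> par j b -> par k c -> par l d ->
             brB (classJ a b) (classJ c d)
             = Bs_class (actJ (i (+) j) (ldot i j a b) k c d),
          forall (i j k l : bool) (a b : jtJ T) (m n : jtM T),
             par i a -> par j b -> par k m -> par l n ->
             brB (classJ a b) (classM m n)
             = Bs_class (actM (i (+) j) (ldot i j a b) k m n)
        & forall (i j k l : bool) (m n r s : jtM T),
             par i m -> par j n -> par k r -> par l s ->
             brB (classM m n) (classM r s)
             = Bs_class (actM (i (+) j) (part i j m n) k r s)],
      forall (p q : bool) (D E : InnDer T),
        InnDer_par T p D -> InnDer_par T q E ->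
        innder_val (brI D E) = supercomm p q (innder_val D) (innder_val E),
      (forall (i j : bool) (a b : jtJ T), par i a -> par j b ->
         innder_val (phi (classJ a b)) = ldot i j a b) /\
      (forall (i j : bool) (m n : jtM T), par i m -> par j n ->
         innder_val (phi (classM m n)) = part i j m n)
    & is_central_extension (Bs_par T) (InnDer_par T) brB brI phi].
Proof.
have lieB : is_lie_superalgebra (Bs_par T) (@brB K T).
  split=> [|i j x y|p q x y px qy|i j k x y z].
  - exact: Bs_superspace.
  - exact: brB_par.
  - apply/eqP; rewrite -subr_eq0 scaleNr opprK; apply/eqP.
    exact: brB_anti px qy.
  - exact: brB_jacobi.
exists (@brB K T), (@brI K T), (@phi K T); split=> //.
- split=> [i j k l a b c d pa pb pc pd|i j k l a b m n pa pb pm pn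
          |i j k l m n r s pm pn pr ps].
  + apply: etrans (brB_JJ _ pa pb pc) _.
    by rewrite /actJ (linD Bs_class) (linZ Bs_class).
  + apply: etrans (brB_JM _ pa pb pm) _.
    by rewrite /actM (linD Bs_class) (linZ Bs_class).
  + apply: etrans (brB_MM _ pm pn pr) _.
    by rewrite /actM (linD Bs_class) (linZ Bs_class).
- by move=> p q D E; apply: sbracket_hom.
- by split=> i j u v pu pv; [apply: phiEJ|apply: phiEM].
split=> //.
- exact: InnDer_lie.
- by move=> i x; apply: phiE_par.
- by move=> x y; apply: val_inj; apply: phiE_brB.
- move=> D; have [x xD] : exists x, phiE x = innder_val D.
    move: (innder_valP D); move: (innder_val D); apply: span_ind => [|c E F GE [y <-]].
      by exists 0; apply: phiE0.
    have [x <-] : exists x, phiE x = E.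
      case: GE => [i j a b pa pb|i j m n pm pn].
        by exists (classJ a b); apply: phiEJ.
      by exists (classM m n); apply: phiEM.
    by exists (c *: x + y); apply: phiE_linear.
  by exists x; apply: val_inj.
- move=> x phix y; have x0 : phiE x = 0 := congr1 (@innder_val K T) phix.
  apply: etrans (congr1 (fun F => Bs_act F y) x0) _.
  exact: (linear_at0 (f := fun F => Bs_act F y) (fun c D E => Bs_act_linl c D E y)).
Qed.

Local Open Scope complex_scope.

Theorem theorem4p10 (R : realType) (T : jternary R[i]) :
  exists (brB : {bilinear Bs T -> Bs T -> Bs T})
         (brI : {bilinear InnDer T -> InnDer T -> InnDer T})
         (phi : {linear Bs T -> InnDer T}),
  [/\ is_lie_superalgebra (Bs_par T) brB,
      [/\ forall (i j k l : bool) (a b c d : jtJ T),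
             par i a -> par j b -> par k c -> par l d ->
             brB (classJ a b) (classJ c d)
             = Bs_class (actJ (i (+) j) (ldot i j a b) k c d),
          forall (i j k l : bool) (a b : jtJ T) (m n : jtM T),
             par i a -> par j b -> par k m -> par l n ->
             brB (classJ a b) (classM m n)
             = Bs_class (actM (i (+) j) (ldot i j a b) k m n)
        & forall (i j k l : bool) (m n r s : jtM T),
             par i m -> par j n -> par k r -> par l s ->
             brB (classM m n) (classM r s)
             = Bs_class (actM (i (+) j) (part i j m n) k r s)],
      forall (p q : bool) (D E : InnDer T),
        InnDer_par T p D -> InnDer_par T q E ->
        innder_val (brI D E) = supercomm p q (innder_val D) (innder_val E),
      (forall (i j : bool) (a b : jtJ T), par i a -> par j b ->
         innder_val (phi (classJ a b)) = ldot i j a b) /\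
      (forall (i j : bool) (m n : jtM T), par i m -> par j n ->
         innder_val (phi (classM m n)) = part i j m n)
    & is_central_extension (Bs_par T) (InnDer_par T) brB brI phi].
Proof. exact: central_extension. Qed.
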